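(* Consider, for each $n$, the fixed-design linear model $Y_i=\mathbf{X}_i'\boldsymbol{\beta}+\varepsilon_i$, $i=1,\dots,n$, with $p_n$ covariates of which the first $k_n$ have nonzero coefficients and the remaining $m_n=p_n-k_n$ have zero coefficients, and let $\widehat{\boldsymbol{\beta}}_n=(\widehat{\boldsymbol{\beta}}_{1n}',\widehat{\boldsymbol{\beta}}_{2n}')'$ be the LS-SCAD estimator with penalty parameters $\lambda_n>0$ and $a>2$ (all as set out in the context). Let $d$ be a fixed positive integer and let $\{\mathbf{A}_n,n=1,2,\dots\}$ be a sequence of (nonrandom) matrices of dimension $d\times k_n$ with full row rank. Suppose that: (i) the $\varepsilon_i$ are i.i.d. with mean $0$ and variance $\sigma^2$; (ii) for every $j\in\{1,\dots,p_n\}$ the $j$-th column $\mathbb{X}_{\cdot j}$ of $\mathbb{X}$ satisfies $\|\mathbb{X}_{\cdot j}\|^2=n$; (iii) $\lim_{n\to\infty}\sqrt{k_n}\,\lambda_n/\sqrt{\rho_{n,1}}=0$ and $\lim_{n\to\infty}\sqrt{p_n}/\sqrt{n\rho_{n,1}}=0$; (iv) $\lim_{n\to\infty}\sqrt{k_n}\,\lambda_n/(\sqrt{\rho_{n,1}}\min_{1\le j\le k_n}|\beta_j|)=0$, $\lim_{n\to\infty}\sqrt{p_n}/(\sqrt{n\rho_{n,1}}\min_{1\le j\le k_n}|\beta_j|)=0$, and $\lim_{n\to\infty}\sqrt{p_n/n}/\rho_{n,1}=0$; (v) $\lim_{n\to\infty}\sqrt{\max(\pi_{n,k_n},\omega_{n,m_n})\,p_n}/(\sqrt{n}\,\rho_{n,1}\lambda_n)=0$;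 (vi) $\lim_{n\to\infty}\max_{1\le i\le n}\mathbf{X}_{i1}'\left(\sum_{l=1}^n\mathbf{X}_{l1}\mathbf{X}_{l1}'\right)^{-1}\mathbf{X}_{i1}=0$, where $\rho_{n,1}$ is the smallest eigenvalue of $n^{-1}\mathbb{X}'\mathbb{X}$, and $\pi_{n,k_n}$, $\omega_{n,m_n}$ are the largest eigenvalues of $n^{-1}\mathbb{X}_1'\mathbb{X}_1$ and $n^{-1}\mathbb{X}_2'\mathbb{X}_2$, respectively. Then $$\sqrt{n}\,\Sigma_n^{-1/2}\mathbf{A}_n(\widehat{\boldsymbol{\beta}}_{1n}-\boldsymbol{\beta}_1)\xrightarrow{D}N(\mathbf{0}_d,I_d)\quad\text{as }n\to\infty,$$ where $\Sigma_n=\sigma^2\mathbf{A}_n\left(\sum_{i=1}^n\mathbf{X}_{i1}\mathbf{X}_{i1}'/n\right)^{-1}\mathbf{A}_n'$.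
   Context: Setting. For each $n$, observations $(\mathbf{X}_i,Y_i)$, $i=1,\dots,n$, satisfy $Y_i=\mathbf{X}_i'\boldsymbol{\beta}+\varepsilon_i$ (the intercept is taken to be $0$), where $\mathbf{X}_i=(X_{i1},\dots,X_{ip_n})'$ is a $p_n\times1$ vector, $\varepsilon_i$ is a random error, and $\boldsymbol{\beta}=(\beta_1,\dots,\beta_{p_n})'\in\mathbb{R}^{p_n}$. The covariates $X_{ij}$ and parameters $p_n,k_n,\boldsymbol{\beta},\lambda_n$ may depend on $n$; $a>2$ and $\sigma^2$ (positive, since $\Sigma_n$ is inverted) are fixed, and the error distribution does not change with $n$. In the fixed design setting the $X_{ij}$ are nonrandom. Write $\boldsymbol{\beta}=(\boldsymbol{\beta}_1',\boldsymbol{\beta}_2')'$ with $\boldsymbol{\beta}_1=(\beta_1,\dots,\beta_{k_n})'$ having all components nonzero and $\boldsymbol{\beta}_2=\mathbf{0}_{m_n}$, $m_n=p_n-k_n$. Correspondingly $\mathbf{X}_{i1}=(X_{i1},\dots,X_{ik_n})'$ (a vector). Let $\mathbf{Y}=(Y_1,\dots,Y_n)'$ and let $\mathbb{X}=(X_{ij})$ be the $n\times p_n$ design matrix, partitioned as $\mathbb{X}=(\mathbb{X}_1,\mathbb{X}_2)$ with $\mathbb{X}_1$ of size $n\times k_n$ and $\mathbb{X}_2$ of size $n\times m_n$. $\|\cdot\|$ is the Euclidean norm, $\xrightarrow{D}$ is convergence in distribution. Conditions with $\rho_{n,1}$ in a denominator are understood with $\rho_{n,1}>0$. SCAD penalty.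 For $a>2$, $\lambda>0$: $p_\lambda(\theta;a)=\lambda|\theta|$ if $|\theta|\le\lambda$; $p_\lambda(\theta;a)=-(\theta^2-2a\lambda|\theta|+\lambda^2)/[2(a-1)]$ if $\lambda<|\theta|\le a\lambda$; $p_\lambda(\theta;a)=(a+1)\lambda^2/2$ if $|\theta|>a\lambda$. LS-SCAD estimator. $\widehat{\boldsymbol{\beta}}_n=\arg\min_{\mathbf{b}\in\mathbb{R}^{p_n}}Q_n(\mathbf{b};\lambda_n,a)$, where $Q_n(\mathbf{b};\lambda_n,a)=\|\mathbf{Y}-\mathbb{X}\mathbf{b}\|^2+n\sum_{j=1}^{p_n}p_{\lambda_n}(b_j;a)$ (a global minimizer). It is partitioned as $\widehat{\boldsymbol{\beta}}_n=(\widehat{\boldsymbol{\beta}}_{1n}',\widehat{\boldsymbol{\beta}}_{2n}')'$ with $\widehat{\boldsymbol{\beta}}_{1n}\in\mathbb{R}^{k_n}$, $\widehat{\boldsymbol{\beta}}_{2n}\in\mathbb{R}^{m_n}$. *)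

(* Defs.v *)
From HB Require Import structures.
From mathcomp Require Import all_boot all_order all_algebra.
From mathcomp Require Import all_classical all_reals all_analysis.

Set Implicit Arguments.
Unset Strict Implicit.
Unset Printing Implicit Defensive.

Import Order.TTheory GRing.Theory Num.Theory.
Import numFieldNormedType.Exports.

Local Open Scope classical_set_scope.
Local Open Scope ring_scope.

Definition enorm (R : realType) (n : nat) (v : 'cV[R]_n) : R :=
  Num.sqrt (\sum_(i < n) v i 0 ^+ 2).

(* [inf] and [sup] are attained for a symmetric matrix of positive size, whose
   spectrum is finite and nonempty; both are [0] for the empty matrix. *)
Definition min_eigenvalue (R : realType) (n : nat) (M : 'M[R]_n) : R :=
  inf [set a | eigenvalue M a].

Definition max_eigenvalue (R : realType) (n : nat) (M : 'M[R]_n) : R :=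
  sup [set a | eigenvalue M a].

Definition psd (R : realType) (n : nat) (M : 'M[R]_n) : Prop :=
  M^T = M /\ forall u : 'cV[R]_n, 0 <= (u^T *m M *m u) 0 0.

(* The principal square root: a positive semidefinite [S] has exactly one
   positive semidefinite root, so the choice made by [xget] is forced; the
   value is [0] when [S] is not positive semidefinite. *)
Definition sqrtmx (R : realType) (n : nat) (S : 'M[R]_n) : 'M[R]_n :=
  xget 0 [set B | psd B /\ B *m B = S].

Definition invsqrtmx (R : realType) (n : nat) (S : 'M[R]_n) : 'M[R]_n :=
  invmx (sqrtmx S).

Definition scad (R : realType) (lambda a theta : R) : R :=
  if `|theta| <= lambda then lambda * `|theta|
  else if `|theta| <= a * lambda then
    - (theta ^+ 2 - 2 * a * lambda * `|theta| + lambda ^+ 2) / (2 * (a - 1))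
  else (a + 1) * lambda ^+ 2 / 2.

Definition scad_objective (R : realType) (n p : nat) (X : 'M[R]_(n, p))
    (Y : 'cV[R]_n) (lambda a : R) (b : 'cV[R]_p) : R :=
  enorm (Y - X *m b) ^+ 2 + n%:R * \sum_(j < p) scad lambda a (b j 0).

Definition is_ls_scad (R : realType) (n p : nat) (X : 'M[R]_(n, p))
    (Y : 'cV[R]_n) (lambda a : R) (bhat : 'cV[R]_p) : Prop :=
  forall b : 'cV[R]_p,
    scad_objective X Y lambda a bhat <= scad_objective X Y lambda a b.

Definition obs (R : realType) (n p : nat) (X : 'M[R]_(n, p)) (i : 'I_n) :
  'cV[R]_p := (row i X)^T.

Definition gram (R : realType) (n p : nat) (X : 'M[R]_(n, p)) : 'M[R]_p :=
  \sum_(i < n) obs X i *m (obs X i)^T.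

Definition mutually_independent (disp : measure_display)
    (T : measurableType disp) (R : realType) (P : probability T R)
    (I : finType) (X : I -> {RV P >-> R}) : Prop :=
  forall (J : {set I}) (B : I -> set R), (forall i, measurable (B i)) ->
    P (\bigcap_(i in [set` J]) X i @^-1` B i) =
    (\prod_(i in J) P (X i @^-1` B i))%E.

Definition iid_with_law (disp : measure_display)
    (T : measurableType disp) (R : realType) (P : probability T R)
    (I : finType) (X : I -> {RV P >-> R})
    (nu : probability (measurableTypeR R) R) : Prop :=
  mutually_independent X /\
  forall i (B : set R), measurable B -> distribution P (X i) B = nu B.

Definition cons_pair (R : realType) (d : nat)
    (z : measurableTypeR R * d.-tuple (measurableTypeR R)) :
  d.+1.-tuple (measurableTypeR R) := [tuple of z.1 :: z.2].

Lemma measurable_cons_pair (R : realType) (d : nat) :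
  measurable_fun setT (@cons_pair R d).
Proof. exact: measurable_cons. Qed.

HB.instance Definition _ (R : realType) (d : nat) :=
  isMeasurableFun.Build _ _ _ _ (@cons_pair R d) (@measurable_cons_pair R d).

Fixpoint std_normal (R : realType) (d : nat) :
    probability (d.-tuple (measurableTypeR R)) R :=
  match d with
  | 0 => dirac [tuple]
  | d'.+1 => distribution (normal_prob 0 1 \x std_normal R d')%E (@cons_pair R d')
  end.

Lemma std_normal_box (R : realType) (d : nat)
    (A : 'I_d -> set (measurableTypeR R)) :
  (forall i, measurable (A i)) ->
  std_normal R d [set t | forall i, A i (tnth t i)] =
  (\prod_(i < d) normal_prob 0 1 (A i))%E.
Proof.
elim: d A => [|d IH] A mA.
  by rewrite big_ord0 /= diracE mem_set// => -[].
rewrite big_ord_recl /= /distribution /pushforward.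
rewrite (_ : _ @^-1` _ =
  A ord0 `*` [set t | forall i, A (lift ord0 i) (tnth t i)]); last first.
  apply/seteqP; split=> -[x t] /=.
    move=> h; split; first by have := h ord0.
    by move=> i; have := h (lift ord0 i); rewrite tnthS.
  move=> [h0 h] i; have [j ->|->] := unliftP ord0 i; last exact: h0.
  by rewrite tnthS; exact: h.
have mB : measurable
    [set t : d.-tuple (measurableTypeR R) |
      forall i, A (lift ord0 i) (tnth t i)].
  rewrite (_ : mkset _ = \bigcap_(i in [set: 'I_d])
      (@tnth d (measurableTypeR R) ^~ i @^-1` A (lift ord0 i))); last first.
    by apply/seteqP; split=> [t h i _|t h i]; [exact: h|exact: (h i I)].
  apply: fin_bigcap_measurable => [|i _].
    exact: finite_finset.
  by rewrite -[X in measurable X]setTI; apply: measurable_tnth.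
rewrite [LHS]product_measure1E//=; congr (_ * _)%E.
by apply: IH => i; exact: mA.
Qed.

Definition joint_cdf (R : realType) (d : nat)
    (mu : probability (d.-tuple (measurableTypeR R)) R) (x : 'cV[R]_d) :
    \bar R :=
  mu [set t | forall i, tnth t i <= x i 0].

Definition cvg_in_distribution (R : realType) (disp : nat -> measure_display)
    (T : forall n, measurableType (disp n))
    (P : forall n, probability (T n) R) (d : nat)
    (Z : forall n, T n -> 'cV[R]_d)
    (mu : probability (d.-tuple (measurableTypeR R)) R) : Prop :=
  forall x : 'cV[R]_d, {for x, continuous (joint_cdf mu)} ->
    P n [set w | forall i, Z n w i 0 <= x i 0] @[n --> \oo] --> joint_cdf mu x.

(* Main.v *)
Require Import Defs.
From HB Require Import structures.
From mathcomp Require Import all_boot all_order all_algebra.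
From mathcomp Require Import all_classical all_reals all_analysis.
From mathcomp Require Import measurable_realfun.
From mathcomp Require Import complex ring lra.

Set Implicit Arguments.
Unset Strict Implicit.
Unset Printing Implicit Defensive.

Import Order.TTheory GRing.Theory Num.Theory.
Import numFieldNormedType.Exports.

Local Open Scope classical_set_scope.
Local Open Scope ring_scope.

(* Write e for the vector of errors and H for the orthogonal projection on the
   column space of X.  Since E |He|^2 = p sigma^2, Markov's inequality gives
   |He|^2 <= p T outside an event of small probability.  On that event a purely
   deterministic argument, comparing the SCAD objective at the minimizer with its
   value at beta and then at perturbations of one coordinate, shows that the
   zero coefficients are estimated by 0 and the others by least squares on X1.
   The normalized estimator is therefore W e with W W' = sigma^-2 I, and the
   leverage condition makes the columns of W uniformly small.  The central limit
   theorem for W e is obtained by Lindeberg's replacement of the errors, one at a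
   time, by Gaussian variables, tested against products of smooth steps that
   approximate indicators of orthants; the Gaussian side depends only on W W'
   because a product of standard Gaussian laws is invariant under plane
   rotations. *)

(** * Symmetric matrices and quadratic forms *)

(** The errors have only second moments, so a cubic Taylor remainder cannot be integrated;
    remainders are kept in the form [y ^+ 2 * Num.min 1 (s * |y|)], which is dominated by [y ^+ 2]
    and tends to 0 with [s]. The probability space, the dimensions and the weights all change with
    n, so the limit theorem is proved as a bound for a single n, with a threshold on the column
    norms that depends only on the error law, the point and the tolerance. A sum of independent
    terms appears as a composition of operators sending f to the function x -> E f(x + y w); these
    commute and are contractions for the sup norm, so the cost of one replacement has to be
    estimated only on the test function itself. On the regression side, the normalization of the
    columns puts 1 on the diagonal of the Gram matrix divided by n; hence its smallest eigenvalue is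
    at most 1 and [Num.max (pi1 n) (omega2 n)] is at least 1, which makes rate conditions of
    different shapes comparable. *)

Lemma poly_interpolation (F : fieldType) (s : seq F) (g : F -> F) :
  uniq s -> exists q : {poly F}, forall x, x \in s -> q.[x] = g x.
Proof.
elim: s => [|a s IH] /=; first by exists 0.
move=> /andP[as_ /IH[q qE]].
pose r := \prod_(y <- s) ('X - y%:P).
have ra : r.[a] != 0 by rewrite -rootE root_prod_XsubC.
exists (q + ((g a - q.[a]) / r.[a]) *: r) => x.
rewrite inE hornerD hornerZ => /orP[/eqP ->|xs].
  by rewrite divfK// addrC subrK.
have /rootP -> : root r x by rewrite root_prod_XsubC.
by rewrite mulr0 addr0 qE.
Qed.

Lemma trmx_horner_mx (F : comNzRingType) n (A : 'M[F]_n.+1) (q : {poly F}) :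
  A^T = A -> (horner_mx A q)^T = horner_mx A q.
Proof.
move=> As.
elim/poly_ind: q => [|q c IH]; first by rewrite rmorph0 trmx0.
rewrite rmorphD rmorphM/= horner_mx_X horner_mx_C linearD/= tr_scalar_mx.
congr (_ + _); rewrite -mulmxE trmx_mul IH As mulmxE.
by rewrite -{1 4}(horner_mx_X A) -!rmorphM mulrC.
Qed.

(** The spectral theorem is applied over the complex numbers; taking [B] to be a polynomial in [M]
    keeps the root real and symmetric. The polynomial interpolates fourth roots of the eigenvalues
    rather than square roots, because the square root of [M] is then itself the square of a
    symmetric matrix, so that its quadratic form is a sum of squares. *)
Lemma sym_sqrt (R : realType) n (M : 'M[R]_n) : M^T = M ->
  (forall a, eigenvalue M a -> 0 <= a) ->
  exists B : 'M[R]_n, [/\ B^T = B, psd (B *m B) & (B *m B) *m (B *m B) = M].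
Proof.
move=> Ms Mge0.
case: n M Ms Mge0 => [|n] M Ms Mge0.
  exists 0; split; [by apply/matrixP => -[]| |by apply/matrixP => -[]].
  split; first by apply/matrixP => -[].
  by move=> u; rewrite mxE big_ord0.
pose f := real_complex R.
pose A := map_mx f M.
have Ah : A \is hermsymmx.
  apply: realsym_hermsym.
    apply/is_hermitianmxP; rewrite expr0 scale1r map_mx_id//.
    by rewrite /A map_trmx Ms.
  by apply/mxOverP => i j; rewrite mxE; apply/complex_realP; exists (M i j).
have /hermitian_normalmx/orthomx_spectralP := Ah.
have := hermitian_spectral_diag_real Ah.
have Pu := spectral_unit A.
move: (spectralmx A) (spectral_diag A) Pu => P sp Pu spR AE.
pose d i := complex.Re (sp 0 i).
have spE i : sp 0 i = f (d i).
  by have /complex_realP[x xE] := mxOverP spR 0 i; rewrite /d xE.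
have dge0 i : 0 <= d i.
  apply: Mge0; rewrite -(eigenvalue_map f) -/A; apply/eigenvalueP.
  exists (row i P); last first.
    apply/eqP => P0; have : row i (P *m invmx P) = 0 by rewrite row_mul P0 mul0mx.
    rewrite mulmxV// => /rowP /(_ i); rewrite !mxE eqxx => /eqP.
    by rewrite oner_eq0.
  rewrite {1}AE -row_mul !mulmxA mulmxV// mul1mx.
  transitivity (sp 0 i *: row i P); last by rewrite spE.
  by apply/rowP => j; rewrite mxE mul_diag_mx !mxE.
have [q qE] := poly_interpolation (fun x => Num.sqrt (Num.sqrt x))
  (undup_uniq [seq d i | i : 'I_n.+1]).
have {}qE i : q.[d i] ^+ 4 = d i.
  rewrite qE ?mem_undup ?map_f ?mem_enum// -[4%N]/(2 * 2)%N exprM.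
  by rewrite !sqr_sqrtr// sqrtr_ge0.
pose B := horner_mx M q.
have Bs : B^T = B by exact: trmx_horner_mx.
have B4 : (B *m B) *m (B *m B) = M.
  apply: (@map_mx_inj _ _ f) => //; rewrite !map_mxM -/A /B.
  have -> : map_mx f (horner_mx M q) =
      invmx P *m diag_mx (\row_i f q.[d i]) *m P.
    have Pu' : P \is a GRing.unit by [].
    transitivity (horner_mx A (map_poly f q)); first exact: map_horner_mx.
    rewrite AE (horner_mx_uconjC _ _ Pu') horner_mx_diag.
    congr (_ *m diag_mx _ *m _); apply/rowP => i.
    by rewrite !mxE spE horner_map.
  rewrite -!mulmxA !(mulmxA P) !mulmxV// !mul1mx !mulmxA.
  rewrite [in RHS]AE; congr (_ *m P); rewrite -!mulmxA; congr (_ *m _).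
  rewrite !mulmx_diag; congr diag_mx; apply/rowP => i; rewrite !mxE spE.
  by rewrite -!rmorphM/= -[in RHS]qE !exprS expr0 mulr1.
exists B; split => //; split; first by rewrite trmx_mul Bs.
move=> u; rewrite !mulmxA -{1}Bs -trmx_mul -mulmxA mxE sumr_ge0// => i _.
by rewrite !mxE -expr2 sqr_ge0.
Qed.

Definition dot (R : realType) n (u v : 'cV[R]_n) : R := (u^T *m v) 0 0.

Lemma dotE (R : realType) n (u v : 'cV[R]_n) : dot u v = \sum_i u i 0 * v i 0.
Proof. by rewrite /dot mxE; apply: eq_bigr => i _; rewrite mxE. Qed.

Lemma dotC (R : realType) n (u v : 'cV[R]_n) : dot u v = dot v u.
Proof. by rewrite !dotE; apply: eq_bigr => i _; rewrite mulrC. Qed.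

Lemma dotDr (R : realType) n (u v w : 'cV[R]_n) :
  dot u (v + w) = dot u v + dot u w.
Proof. by rewrite /dot mulmxDr mxE. Qed.

Lemma dotZr (R : realType) n a (u v : 'cV[R]_n) : dot u (a *: v) = a * dot u v.
Proof. by rewrite /dot -scalemxAr mxE. Qed.

Lemma dotZl (R : realType) n a (u v : 'cV[R]_n) : dot (a *: u) v = a * dot u v.
Proof. by rewrite dotC dotZr dotC. Qed.

Lemma dotNr (R : realType) n (u v : 'cV[R]_n) : dot u (- v) = - dot u v.
Proof. by rewrite -scaleN1r dotZr mulN1r. Qed.

Lemma dotBr (R : realType) n (u v w : 'cV[R]_n) :
  dot u (v - w) = dot u v - dot u w.
Proof. by rewrite dotDr dotNr. Qed.

Lemma dotBl (R : realType) n (u v w : 'cV[R]_n) :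
  dot (v - w) u = dot v u - dot w u.
Proof. by rewrite !(dotC _ u) dotBr. Qed.

Lemma dot_mulmx (R : realType) m n (M : 'M[R]_(m, n)) (u : 'cV_n) (v : 'cV_m) :
  dot (M *m u) v = dot u (M^T *m v).
Proof. by rewrite /dot trmx_mul mulmxA. Qed.

Lemma enorm_sqr (R : realType) n (v : 'cV[R]_n) : enorm v ^+ 2 = dot v v.
Proof.
rewrite /enorm sqr_sqrtr; last by apply: sumr_ge0 => i _; rewrite sqr_ge0.
by rewrite dotE; apply: eq_bigr => i _; rewrite expr2.
Qed.

Lemma enorm_ge0 (R : realType) n (v : 'cV[R]_n) : 0 <= enorm v.
Proof. exact: sqrtr_ge0. Qed.

Lemma enorm_eq0 (R : realType) n (v : 'cV[R]_n) : enorm v = 0 -> v = 0.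
Proof.
move=> v0; apply/colP => i; rewrite mxE.
have := enorm_sqr v; rewrite v0 expr0n/= dotE => /esym/eqP.
rewrite psumr_eq0; last by move=> j _; rewrite -expr2 sqr_ge0.
by move=> /allP /(_ i (mem_index_enum _)); rewrite -expr2 sqrf_eq0 => /eqP.
Qed.

Lemma normr_le_enorm (R : realType) n (v : 'cV[R]_n) i : `|v i 0| <= enorm v.
Proof.
rewrite /enorm -sqrtr_sqr ler_wsqrtr// (bigD1 i)//= lerDl sumr_ge0// => j _.
exact: sqr_ge0.
Qed.

Lemma cauchy_schwarz (R : realType) n (u v : 'cV[R]_n) :
  dot u v ^+ 2 <= enorm u ^+ 2 * enorm v ^+ 2.
Proof.
have [v0|v0] := eqVneq (enorm v) 0.
  by rewrite (enorm_eq0 v0) /dot mulmx0 mxE expr0n/= mulr_ge0// sqr_ge0.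
have vgt0 : 0 < enorm v ^+ 2 by rewrite exprn_even_gt0.
have := sqr_ge0 (enorm (enorm v ^+ 2 *: u - dot u v *: v)).
rewrite [enorm (_ - _) ^+ 2]enorm_sqr dotBl !dotBr !dotZl !dotZr (dotC v u) -!enorm_sqr.
move: (enorm v ^+ 2) (enorm u ^+ 2) (dot u v) vgt0 => V U c V0.
have -> : V * (V * U) - V * (c * c) - (c * (V * c) - c * (c * V)) =
  V * (U * V - c ^+ 2) by ring.
by rewrite pmulr_rge0// subr_ge0.
Qed.

Lemma eigenvalue_quadform (R : realType) n (M : 'M[R]_n) a : M^T = M ->
  eigenvalue M a -> exists2 v : 'cV[R]_n, 0 < enorm v ^+ 2 & dot v (M *m v) = a * enorm v ^+ 2.
Proof.
move=> Ms /eigenvalueP[v vE v0]; exists v^T; last first.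
  by rewrite -{1}Ms -trmx_mul vE linearZ/= dotZr enorm_sqr.
rewrite exprn_even_gt0//=; apply: contra_neq v0 => /enorm_eq0 v0.
by rewrite -[v]trmxK v0 trmx0.
Qed.

Lemma quadform_bound (R : realType) n (M : 'M[R]_n) :
  exists C, forall u : 'cV[R]_n, `|dot u (M *m u)| <= C * enorm u ^+ 2.
Proof.
exists (\sum_i \sum_j `|M i j|) => u.
rewrite dotE (le_trans (ler_norm_sum _ _ _))// mulr_suml ler_sum// => i _.
rewrite normrM mxE mulr_suml (le_trans (ler_wpM2l (normr_ge0 _)
  (ler_norm_sum _ _ _)))// mulr_sumr ler_sum// => j _.
by rewrite normrM mulrCA ler_wpM2l// expr2 ler_pM// normr_le_enorm.
Qed.

(** Subtracting the infimum from the diagonal leaves a symmetric matrix with nonnegative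
    eigenvalues, hence a square of a symmetric matrix. The crude bound on the quadratic form serves
    only to show that the spectrum is bounded below, so that [inf] is a genuine lower bound. *)
Lemma min_eigenvalue_le (R : realType) n (M : 'M[R]_n) (u : 'cV[R]_n) :
  M^T = M -> min_eigenvalue M * enorm u ^+ 2 <= dot u (M *m u).
Proof.
move=> Ms; set r := min_eigenvalue M.
have [C MC] := quadform_bound M.
have lb : has_lbound [set a | eigenvalue M a].
  exists (- C) => a /= /(eigenvalue_quadform Ms)[v v0 vE].
  have := MC v; rewrite vE ler_norml => /andP[+ _].
  by rewrite -mulNr ler_pM2r.
have Ns : (M - r%:M)^T = M - r%:M by rewrite linearB/= Ms tr_scalar_mx.
have [a|B [Bs _ BB]] := sym_sqrt Ns.
  move=> /eigenvalueP[v vE v0].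
  have : r <= a + r.
    apply: ge_inf => //=; apply/eigenvalueP; exists v => //.
    by move: vE; rewrite mulmxBr mul_mx_scalar scalerDl => <-; rewrite subrK.
  by rewrite lerDr.
have BBs : (B *m B)^T = B *m B by rewrite trmx_mul Bs.
have : 0 <= dot u ((M - r%:M) *m u).
  by rewrite -BB -mulmxA -{1}BBs -dot_mulmx -enorm_sqr sqr_ge0.
by rewrite mulmxBl dotBr mul_scalar_mx dotZr -enorm_sqr subr_ge0.
Qed.

Lemma max_eigenvalueE (R : realType) n (M : 'M[R]_n) :
  max_eigenvalue M = - min_eigenvalue (- M).
Proof.
rewrite /max_eigenvalue /min_eigenvalue /inf opprK; congr sup.
apply/seteqP; split=> [a|a [b]] /=; last first.
  move=> /eigenvalueP[v vE v0] <-; apply/eigenvalueP; exists v => //.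
  by rewrite scaleNr -vE mulmxN opprK.
move=> /eigenvalueP[v vE v0]; exists (- a); rewrite ?opprK//.
by apply/eigenvalueP; exists v => //; rewrite mulmxN vE scaleNr.
Qed.

Lemma le_max_eigenvalue (R : realType) n (M : 'M[R]_n) (u : 'cV[R]_n) :
  M^T = M -> dot u (M *m u) <= max_eigenvalue M * enorm u ^+ 2.
Proof.
move=> Ms; have Ns : (- M)^T = - M by rewrite linearN/= Ms.
have := min_eigenvalue_le u Ns; rewrite max_eigenvalueE mulNmx dotNr.
by move=> ?; rewrite mulNr lerNr.
Qed.

Lemma gramE (R : realType) n p (X : 'M[R]_(n, p)) : gram X = X^T *m X.
Proof.
apply/matrixP => i j; rewrite /gram summxE mxE; apply: eq_bigr => l _.
by rewrite mxE big_ord1 !mxE.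
Qed.

Lemma row_free_mul_tr (R : realType) d n (M : 'M[R]_(d, n)) :
  row_free M -> M *m M^T \in unitmx.
Proof.
move=> Mfree; rewrite -row_free_unit; apply: inj_row_free => v vMM.
have : enorm (M^T *m v^T) = 0.
  have MMv : M *m M^T *m v^T = 0.
    by apply: trmx_inj; rewrite !trmx_mul !trmxK vMM trmx0.
  apply/eqP; rewrite -sqrf_eq0 enorm_sqr dot_mulmx trmxK mulmxA MMv.
  by rewrite /dot mulmx0 mxE.
move/enorm_eq0; rewrite -trmx_mul => /(congr1 trmx); rewrite trmxK trmx0.
by move/eqP; rewrite mulmx_free_eq0// => /eqP.
Qed.

Lemma sqrtmx_spec (R : realType) n (S : 'M[R]_n) : psd S ->
  psd (sqrtmx S) /\ sqrtmx S *m sqrtmx S = S.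
Proof.
move=> [Ss Sge0].
have [a|B [_ Bpsd BB]] := sym_sqrt Ss.
  move=> /(eigenvalue_quadform Ss)[v v0 vE].
  have := Sge0 v; rewrite -mulmxA -/(dot _ _) vE.
  by rewrite pmulr_lge0.
rewrite /sqrtmx; case: xgetP => [B' -> //|/(_ (B *m B))].
by case; split.
Qed.

Lemma sym_idem_diag_ge0 (R : realType) n (M : 'M[R]_n) i :
  M^T = M -> M *m M = M -> 0 <= M i i.
Proof.
move=> Ms Mi; rewrite -Mi mxE sumr_ge0// => j _.
by rewrite -{2}Ms mxE -expr2 sqr_ge0.
Qed.

(** * Weights of the limiting linear form *)

Section weights.
Variables (R : realType) (n k d : nat) (X : 'M[R]_(n, k)) (A : 'M[R]_(d, k)).
Variable sigma : R.
Hypotheses (n0 : (0 < n)%N) (s0 : 0 < sigma).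
Hypotheses (Gu : X^T *m X \in unitmx) (Afree : row_free A).

Let G := X^T *m X.
Let S := sigma ^+ 2 *: (A *m invmx (n%:R^-1 *: gram X) *m A^T).

(** The matrix that carries the errors to the normalized least-squares estimator on the columns of
    [X]. The Gram matrix [G] is not divided by n here, which is why a factor n appears when [S] is
    compared with [C *m C^T]. *)
Definition clt_weights : 'M[R]_(d, n) :=
  Num.sqrt n%:R *: (invsqrtmx S *m A *m invmx G *m X^T).

Let Gs : G^T = G. Proof. by rewrite trmx_mul trmxK. Qed.

Let nR0 : (n%:R : R) != 0. Proof. by rewrite pnatr_eq0 -lt0n. Qed.

Let C := A *m invmx G *m X^T.

Let CC : C *m C^T = A *m invmx G *m A^T.
Proof.
rewrite /C !trmx_mul trmxK trmx_inv Gs !mulmxA; congr (_ *m _).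
by rewrite -!mulmxA (mulmxA X^T) mulmxV// mulmx1.
Qed.

Let SE : S = (sigma ^+ 2 * n%:R) *: (C *m C^T).
Proof.
have Gnu : n%:R^-1 *: G \in unitmx by rewrite unitmxZ// unitfE invr_eq0.
rewrite /S gramE -/G invmxZ// invrK CC.
by rewrite -scalemxAr -scalemxAl scalerA.
Qed.

Let Su : S \in unitmx.
Proof.
rewrite SE unitmxZ ?unitfE ?mulf_neq0// ?sqrf_eq0 ?gt_eqF//.
apply: row_free_mul_tr; apply: inj_row_free => v.
rewrite /C !mulmxA => vC.
have : v *m A *m invmx G *m (X^T *m X) = 0 by rewrite mulmxA vC mul0mx.
rewrite -mulmxA mulVmx// mulmx1 => /eqP.
by rewrite mulmx_free_eq0// => /eqP.
Qed.

Let Bspec : psd (sqrtmx S) /\ sqrtmx S *m sqrtmx S = S.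
Proof.
apply: sqrtmx_spec; split=> [|u]; first by rewrite SE linearZ/= trmx_mul trmxK.
rewrite -mulmxA -/(dot _ _) SE -scalemxAl dotZr -mulmxA -{1}[C]trmxK -dot_mulmx.
by rewrite -enorm_sqr mulr_ge0 ?sqr_ge0// mulr_ge0 ?sqr_ge0// ler0n.
Qed.

Lemma clt_weights_gram : clt_weights *m clt_weights^T = (sigma ^- 2)%:M.
Proof.
have [[Bs _] BB] := Bspec.
have Bu : sqrtmx S \in unitmx.
  by move: Su; rewrite -{1}BB unitmx_mul => /andP[].
have -> : clt_weights = Num.sqrt n%:R *: (invmx (sqrtmx S) *m C).
  by rewrite /clt_weights /C !mulmxA.
rewrite linearZ/= -scalemxAl -scalemxAr scalerA -expr2 sqr_sqrtr ?ler0n//.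
rewrite trmx_mul trmx_inv Bs -mulmxA (mulmxA C).
have -> : C *m C^T = (sigma ^+ 2 * n%:R)^-1 *: S.
  by rewrite SE scalerA mulVf ?scale1r// mulf_neq0// sqrf_eq0 gt_eqF.
move: (sqrtmx S) Bu BB {Bs} => B Bu <-.
rewrite -scalemxAl -scalemxAr scalerA -mulmxA mulmxV// mulmx1 mulVmx//.
by rewrite invfM mulrCA mulfV// mulr1 scalemx1.
Qed.

(** The rescaled matrix [K] of [clt_weights^T *m clt_weights] is an orthogonal projection whose
    range lies in that of the hat matrix [H]. The difference of two nested projections is again a
    symmetric idempotent, so its diagonal is nonnegative, and the diagonal of [H] consists of the
    leverages. *)
Lemma clt_weights_leverage i :
  enorm (col i clt_weights) ^+ 2 <=
  sigma ^- 2 * ((obs X i)^T *m invmx (gram X) *m obs X i) 0 0.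
Proof.
set H := X *m invmx G *m X^T.
have -> : ((obs X i)^T *m invmx (gram X) *m obs X i) 0 0 = H i i.
  rewrite /obs trmxK gramE -/G -row_mul /H mxE [RHS]mxE.
  by apply: eq_bigr => j _; rewrite [in LHS]mxE; congr (_ * _); rewrite !mxE.
set K := sigma ^+ 2 *: (clt_weights^T *m clt_weights).
have -> : enorm (col i clt_weights) ^+ 2 = sigma ^- 2 * K i i.
  rewrite /K [in RHS]mxE mulrA mulVf ?mul1r ?sqrf_eq0 ?gt_eqF//.
  rewrite enorm_sqr dotE mxE.
  by apply: eq_bigr => j _; rewrite !mxE.
rewrite ler_pM2l ?invr_gt0 ?exprn_gt0// -subr_ge0.
have GXX : invmx G *m (X^T *m X) = 1%:M by exact: mulVmx.
have HH : H *m H = H.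
  by rewrite /H -!mulmxA (mulmxA X^T X) (mulmxA (invmx G)) GXX mul1mx.
have Hs : H^T = H by rewrite /H !trmx_mul trmxK trmx_inv Gs mulmxA.
have WH : clt_weights *m H = clt_weights.
  rewrite /clt_weights /H -scalemxAl; congr (_ *: _).
  by rewrite -!mulmxA (mulmxA X^T X) (mulmxA (invmx G)) GXX mul1mx.
have KH : K *m H = K by rewrite /K -scalemxAl -mulmxA WH.
have Ks : K^T = K by rewrite /K linearZ/= trmx_mul trmxK.
have HK : H *m K = K by rewrite -[RHS]Ks -{2}KH trmx_mul Ks Hs.
have KK : K *m K = K.
  rewrite {1 2}/K -scalemxAl -scalemxAr scalerA -mulmxA (mulmxA clt_weights).
  rewrite clt_weights_gram mul_scalar_mx -scalemxAr scalerA mulrK//.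
  by rewrite unitfE sqrf_eq0 gt_eqF.
have : 0 <= (H - K) i i.
  apply: sym_idem_diag_ge0; first by rewrite linearB/= Hs Ks.
  by rewrite mulmxBl !mulmxBr HH HK KH KK subrr subr0.
by rewrite !mxE.
Qed.

End weights.

(** * The least-squares SCAD minimizer *)

Lemma scad_bounds (R : realType) (lambda a t : R) : 0 < lambda -> 2 < a ->
  0 <= scad lambda a t <= (a + 1) * lambda ^+ 2 / 2.
Proof.
move=> l0 a2; rewrite /scad; have ll : 0 < lambda ^+ 2 by rewrite exprn_gt0.
have al : 0 < a * lambda ^+ 2 by rewrite mulr_gt0//; lra.
case: ifPn => [tl|]; last rewrite -ltNge => lt.
  rewrite mulr_ge0//=; last exact: ltW.
  have : lambda * `|t| <= lambda ^+ 2 by rewrite expr2 ler_pM2l.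
  have := ler_wpM2r (ltW ll) (ltW a2); lra.
have [ta|ta] := leP `|t| (a * lambda); last first.
  by rewrite lexx andbT; lra.
have a1 : 0 < 2 * (a - 1) by lra.
rewrite ler_pdivlMr// mul0r ler_pdivrMr//.
rewrite -(real_normK (num_real t)).
have t0 : 0 <= `|t| by [].
by apply/andP; split; nra.
Qed.

Lemma scad0 (R : realType) (lambda a : R) : 0 < lambda -> scad lambda a 0 = 0.
Proof. by move=> l0; rewrite /scad normr0 ltW// mulr0. Qed.

Lemma scad_small (R : realType) (lambda a t : R) :
  `|t| <= lambda -> scad lambda a t = lambda * `|t|.
Proof. by rewrite /scad => ->. Qed.

Lemma scad_big (R : realType) (lambda a t : R) :
  0 < lambda -> 2 < a -> a * lambda < `|t| ->
  scad lambda a t = (a + 1) * lambda ^+ 2 / 2.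
Proof.
move=> l0 a2 ta; rewrite /scad !leNgt ta/= (_ : lambda < `|t|)//.
by apply: lt_trans ta; nra.
Qed.

Lemma scad_objective_shift (R : realType) (lambda a : R) n p
    (X : 'M[R]_(n, p)) (Y : 'cV_n) (b : 'cV_p) j t :
  enorm (col j X) ^+ 2 = n%:R ->
  scad_objective X Y lambda a (b + t *: delta_mx j 0) =
  scad_objective X Y lambda a b
  + (n%:R * t ^+ 2 - 2 * t * dot (Y - X *m b) (col j X))
  + n%:R * (scad lambda a (b j 0 + t) - scad lambda a (b j 0)).
Proof.
move=> Xj; rewrite /scad_objective mulmxDr -scalemxAr -colE opprD addrA.
move: (Y - X *m b) => r0.
rewrite [enorm (_ - t *: _) ^+ 2]enorm_sqr dotBl !dotBr !dotZl !dotZr.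
rewrite (dotC (col j X)) -!enorm_sqr Xj.
rewrite (bigD1 j)//= [in RHS](bigD1 j)//= !mxE !eqxx mulr1.
rewrite [X in n%:R * (_ + X)](eq_bigr (fun i => scad lambda a (b i 0))); last first.
  by move=> i /negbTE ij; rewrite !mxE ij mulr0 addr0.
by ring.
Qed.

Lemma dot_unit_gram (R : realType) n p (X : 'M[R]_(n, p)) (q : R) : 0 < q ->
  (forall u, q * enorm u <= enorm (X *m u)) -> X^T *m X \in unitmx.
Proof.
move=> q0 qX; rewrite -[X in _ *m X]trmxK; apply: row_free_mul_tr.
apply: inj_row_free => v vX.
have Xv : X *m v^T = 0 by apply: trmx_inj; rewrite trmx_mul trmxK vX trmx0.
have := qX v^T; rewrite Xv {2}/enorm big1 ?sqrtr0; last first.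
  by move=> i _; rewrite mxE expr0n.
rewrite pmulr_rle0// => v0.
apply: trmx_inj; rewrite trmx0; apply: enorm_eq0.
by apply/eqP; rewrite eq_le v0 enorm_ge0.
Qed.

(* Comparing the objective at the minimizer with its value at [b0] gives a crude
   bound on the prediction error [s]; it puts all nonzero coefficients in the
   flat region of the penalty, whence the sharp bound [s <= 2 v].  Perturbing
   single coordinates then yields sparsity and the normal equations. *)
Lemma scad_oracle (R : realType) n k m (X : 'M[R]_(n, k + m))
    (b0 bh : 'cV[R]_(k + m)) (e : 'cV[R]_n) (lambda a q v mb r : R) :
  (0 < n)%N -> 0 < lambda -> 2 < a ->
  (forall j, enorm (col j X) ^+ 2 = n%:R) ->
  0 < q -> (forall u, q * enorm u <= enorm (X *m u)) ->
  0 <= v -> (forall u, `|dot e (X *m u)| <= v * enorm (X *m u)) ->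
  dsubmx b0 = 0 -> 0 < mb -> (forall j, mb <= `|usubmx b0 j 0|) ->
  0 <= r -> r ^+ 2 = n%:R * (k%:R * ((a + 1) * lambda ^+ 2 / 2)) ->
  2 * v + r <= q * (mb / 4) -> a * lambda < mb / 2 ->
  6 * v * Num.sqrt n%:R + n%:R * (2 * v / q) < n%:R * lambda ->
  is_ls_scad X (X *m b0 + e) lambda a bh ->
  dsubmx bh = 0 /\
  usubmx bh - usubmx b0 =
    invmx ((lsubmx X)^T *m lsubmx X) *m (lsubmx X)^T *m e.
Proof.
move=> n0 l0 a2 Xn q0 qX v0 vX b02 mb0 mbb r0 r2 N1 N1' N2 opt.
have nR0 : 0 < n%:R :> R by rewrite ltr0n.
set pen := (a + 1) * lambda ^+ 2 / 2 in r2.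
pose u := bh - b0; pose s := enorm (X *m u).
have res : X *m b0 + e - X *m bh = e - X *m u.
  by rewrite /u mulmxBr opprB addrA [e + _]addrC.
have s0 : 0 <= s by exact: enorm_ge0.
have ui j : `|u j 0| <= enorm u by exact: normr_le_enorm.
have b0r j : b0 (rshift k j) 0 = 0.
  by have /colP/(_ j) := b02; rewrite !mxE.
have basic : s ^+ 2 + n%:R * \sum_j scad lambda a (bh j 0) <=
    2 * (v * s) + n%:R * \sum_j scad lambda a (b0 j 0).
  have := opt b0; rewrite /scad_objective res addrAC subrr add0r.
  rewrite [enorm (e - _) ^+ 2]enorm_sqr dotBl !dotBr (dotC (X *m u)) -!enorm_sqr.
  rewrite -/s; have := vX u; rewrite -/s ler_norml => /andP[_]; lra.
have sumb0 : \sum_j scad lambda a (b0 j 0) =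
    \sum_(j < k) scad lambda a (b0 (lshift m j) 0).
  rewrite big_split_ord/= [X in _ + X]big1 ?addr0// => j _.
  by rewrite b0r scad0.
(* If s exceeded 2v + r, then s (s - 2v) would exceed r squared, against the quadratic inequality
   obtained from [basic] by bounding every penalty term at [b0] by its plateau value. *)
have sge : s <= 2 * v + r.
  have : s ^+ 2 <= 2 * (v * s) + r ^+ 2.
    apply: le_trans (_ : s ^+ 2 + n%:R * \sum_j scad lambda a (bh j 0) <= _).
      rewrite lerDl mulr_ge0 ?ler0n//; apply: sumr_ge0 => j _.
      by case/andP: (scad_bounds (bh j 0) l0 a2).
    apply: le_trans basic _; rewrite lerD2l r2 sumb0 ler_pM2l//.
    apply: le_trans (_ : \sum_(j < k) pen <= _).
      by apply: ler_sum => j _; case/andP: (scad_bounds (b0 (lshift m j) 0) l0 a2).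
    by rewrite sumr_const card_ord mulr_natl.
  move=> ss; rewrite leNgt; apply/negP => sr; nra.
have un : enorm u <= mb / 4.
  by rewrite -(ler_pM2l q0) (le_trans (qX u))// (le_trans sge).
have al0 : 0 < a * lambda by nra.
have bhl j : mb * 3 / 4 <= `|bh (lshift m j) 0|.
  have := mbb j; rewrite mxE => mbj.
  have : `|b0 (lshift m j) 0| <= `|bh (lshift m j) 0| + `|u (lshift m j) 0|.
    by rewrite /u !mxE -lerBlDl (distrC (bh _ _)) lerB_dist.
  by have := ui (lshift m j); lra.
(* Each nonzero true coefficient and its estimate are both beyond [a * lambda], so their penalties
   are equal; the other true coefficients have penalty 0. The penalties therefore cancel in [basic]
   in the favourable direction. *)
have s2v : s <= 2 * v.
  have : s ^+ 2 <= 2 * (v * s).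
    have : \sum_j scad lambda a (b0 j 0) <= \sum_j scad lambda a (bh j 0).
      rewrite sumb0 [leRHS]big_split_ord/= -[leLHS]addr0 lerD//; last first.
        by apply: sumr_ge0 => j _; case/andP: (scad_bounds (bh (rshift k j) 0) l0 a2).
      apply: ler_sum => j _; rewrite !scad_big//; first by have := bhl j; lra.
      by have := mbb j; rewrite mxE; lra.
    by rewrite -(ler_pM2l nR0); move: basic; lra.
  move=> ss; rewrite leNgt; apply/negP => sr; nra.
have uq : enorm u <= 2 * v / q.
  by rewrite ler_pdivlMr// mulrC (le_trans (qX u)).
have shift j t : 0 <= (n%:R * t ^+ 2 - 2 * t * dot (e - X *m u) (col j X))
    + n%:R * (scad lambda a (bh j 0 + t) - scad lambda a (bh j 0)).
  have := opt (bh + t *: delta_mx j 0); rewrite scad_objective_shift// res.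
  by rewrite -addrA lerDl.
have Xjn j : enorm (col j X) = Num.sqrt n%:R.
  by rewrite -(Xn j) sqrtr_sqr ger0_norm// enorm_ge0.
(* Moving a nonzero estimate B to 0 saves n lambda |B| of penalty, as |B| <= lambda. The loss rises
   by at most |B| times 6 v sqrt n + n |B|: the residual has inner product at most v sqrt n + 2 v
   sqrt n with a column. The last numerical hypothesis makes the saving larger. *)
have bh2 j : bh (rshift k j) 0 = 0.
  apply/eqP/negPn/negP => bj0; pose i := rshift k j.
  have bjs : `|bh i 0| <= 2 * v / q.
    have := ui i; rewrite /u !mxE b0r subr0 => /le_trans; exact.
  have := shift i (- bh i 0); rewrite subrr (scad0 _ l0) scad_small//; last first.
    rewrite (le_trans bjs)// ltW// -(ltr_pM2l nR0); apply: le_lt_trans N2.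
    by rewrite lerDr mulr_ge0// ?sqrtr_ge0// mulr_ge0.
  have g1 : `|dot e (col i X)| <= v * Num.sqrt n%:R.
    by have := vX (delta_mx i 0); rewrite -colE Xjn.
  have g2 : `|dot (X *m u) (col i X)| <= 2 * v * Num.sqrt n%:R.
    rewrite -(Xjn i); apply: le_trans (_ : s * enorm (col i X) <= _); last first.
      by rewrite ler_wpM2r// enorm_ge0.
    rewrite -ler_sqr ?nnegrE// ?mulr_ge0 ?enorm_ge0// real_normK ?num_real//.
    by rewrite exprMn cauchy_schwarz.
  rewrite dotBl; set d1 := dot e _ in g1 *; set d2 := dot (X *m u) _ in g2 *.
  have bp : 0 < `|bh i 0| by rewrite normr_gt0.
  have : bh i 0 * (d1 - d2) <= `|bh i 0| * (3 * v * Num.sqrt n%:R).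
    rewrite (le_trans (ler_norm _))// normrM ler_wpM2l//.
    by rewrite (le_trans (ler_normB _ _))//; lra.
  have -> : 2 * - bh i 0 * (d1 - d2) = - (2 * (bh i 0 * (d1 - d2))) by ring.
  rewrite sqrrN -(real_normK (num_real (bh i 0))).
  set B := `|bh i 0| in bjs bp *; move: (bh i 0 * (d1 - d2)) => w wB.
  have N3 : B * (6 * v * Num.sqrt n%:R + n%:R * B) < B * (n%:R * lambda).
    rewrite ltr_pM2l//; apply: le_lt_trans N2.
    by rewrite lerD2l ler_pM2l.
  lra.
(* A step along the gradient [g] would strictly decrease the loss at constant penalty. The bound 1/n
   on [c] makes [n c - 2] negative; the bound (mb/4)/|g| keeps the coefficient above mb/2, hence on
   the plateau. *)
have ort j : dot (e - X *m u) (col (lshift m j) X) = 0.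
  set g := dot _ _; apply/eqP/negPn/negP => g0.
  have gp : 0 < `|g| by rewrite normr_gt0.
  pose c := Num.min n%:R^-1 (mb / 4 / `|g|).
  have c0 : 0 < c by rewrite /c lt_min invr_gt0 nR0 !divr_gt0.
  have cn : n%:R * c <= 1 by rewrite mulrC -ler_pdivlMr// mul1r /c ge_min lexx.
  have cg : `|c * g| <= mb / 4.
    by rewrite normrM gtr0_norm// -ler_pdivlMr// /c ge_min lexx orbT.
  have e1 : scad lambda a (bh (lshift m j) 0) = pen.
    by apply: scad_big => //; have := bhl j; lra.
  have e2 : scad lambda a (bh (lshift m j) 0 + c * g) = pen.
    apply: scad_big => //; have := bhl j.
    by have := ler_normB (bh (lshift m j) 0 + c * g) (c * g); rewrite addrK; lra.
  have := shift (lshift m j) (c * g); rewrite e1 e2 subrr mulr0 addr0.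
  rewrite -/g (_ : _ - _ = (c * g ^+ 2) * (n%:R * c - 2)); last by ring.
  rewrite pmulr_rge0; first by lra.
  by rewrite mulr_gt0// exprn_even_gt0.
split; first by apply/colP => j; rewrite !mxE bh2.
have u1E : usubmx bh - usubmx b0 = usubmx u by rewrite /u linearB.
have Xu : X *m u = lsubmx X *m usubmx u.
  rewrite -{1}[X]hsubmxK -{1}[u]vsubmxK mul_row_col.
  have -> : dsubmx u = 0 by apply/colP => j; rewrite !mxE bh2 b0r subrr.
  by rewrite mulmx0 addr0.
have G1u : (lsubmx X)^T *m lsubmx X \in unitmx.
  apply: (dot_unit_gram q0) => w; have := qX (col_mx w 0).
  rewrite -{1}[X]hsubmxK mul_row_col mulmx0 addr0.
  rewrite /enorm [in X in X <= _ -> _]big_split_ord/= [X in _ + X]big1 ?addr0.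
    by under eq_bigr do rewrite col_mxEu.
  by move=> i _; rewrite col_mxEd mxE expr0n.
have normal_eq : (lsubmx X)^T *m e = (lsubmx X)^T *m (lsubmx X) *m usubmx u.
  apply/eqP; rewrite -subr_eq0 -mulmxA -Xu -mulmxBr; apply/eqP/colP => j.
  transitivity (dot (col (lshift m j) X) (e - X *m u)).
    rewrite dotE mxE; apply: eq_bigr => i _; congr (_ * _); by rewrite !mxE.
  by rewrite dotC ort mxE.
by rewrite u1E -mulmxA normal_eq mulKmx.
Qed.

(** * Averages over product measures *)

(** The recursion is that of [std_normal], so the limit law is literally the Gaussian instance and
    one induction serves both the errors and their replacements. *)
Fixpoint iid_power (R : realType) (nu : probability (measurableTypeR R) R)
    (n : nat) : probability (n.-tuple (measurableTypeR R)) R :=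
  match n with
  | 0 => dirac [tuple]
  | n'.+1 => distribution (nu \x iid_power nu n')%E (@cons_pair R n')
  end.

Lemma std_normalE (R : realType) d : std_normal R d = iid_power (normal_prob 0 1) d.
Proof. by elim: d => //= d ->. Qed.

Lemma ge0_integral_iid_power (R : realType) (nu : probability (measurableTypeR R) R)
    n (g : n.+1.-tuple (measurableTypeR R) -> \bar R) :
  measurable_fun setT g -> (forall t, 0 <= g t)%E ->
  (\int[iid_power nu n.+1]_t g t =
   \int[nu]_y \int[iid_power nu n]_t g (cons_pair (y, t)))%E.
Proof.
move=> mg g0.
rewrite /= ge0_integral_distribution// fubini_tonelli1//; last first.
  by move=> x; exact: g0.
exact: (measurableT_comp mg (@measurable_cons_pair R n)).
Qed.

Lemma iid_power_box (R : realType) (nu : probability (measurableTypeR R) R) n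
    (A : 'I_n -> set (measurableTypeR R)) : (forall i, measurable (A i)) ->
  iid_power nu n [set t | forall i, A i (tnth t i)] = (\prod_(i < n) nu (A i))%E.
Proof.
elim: n A => [|n IH] A mA.
  by rewrite big_ord0 /= diracE mem_set// => -[].
rewrite big_ord_recl -IH//= /distribution /pushforward -product_measure1E//=.
  congr (_ _); apply/seteqP; split => -[x t] /=.
    move=> h; split; first by have := h ord0.
    by move=> i; have := h (lift ord0 i); rewrite tnthS.
  move=> [h0 h] i; have [j ->|->] := unliftP ord0 i; last exact: h0.
  by rewrite tnthS; exact: h.
rewrite (_ : mkset _ = \bigcap_(i in [set: 'I_n])
  (@tnth n (measurableTypeR R) ^~ i @^-1` A (lift ord0 i))); last first.
  by apply/seteqP; split=> [t h i _|t h i]; [exact: h|exact: (h i I)].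
apply: fin_bigcap_measurable => [|i _]; first exact: finite_finset.
by rewrite -[X in measurable X]setTI; apply: measurable_tnth.
Qed.

Lemma measurable_tuple_box (R : realType) n (A : 'I_n -> set (measurableTypeR R)) :
  (forall i, measurable (A i)) -> measurable [set t : n.-tuple _ | forall i, A i (tnth t i)].
Proof.
move=> mA; rewrite (_ : mkset _ = \bigcap_(i in [set: 'I_n])
  (@tnth n (measurableTypeR R) ^~ i @^-1` A i)); last first.
  by apply/seteqP; split=> [t h i _|t h i]; [exact: h|exact: (h i I)].
apply: fin_bigcap_measurable => [|i _]; first exact: finite_finset.
by rewrite -[X in measurable X]setTI; apply: measurable_tnth.
Qed.

Lemma tuple_measure_unique (R : realType) n
    (m1 m2 : probability (n.-tuple (measurableTypeR R)) R) :
  (forall A : 'I_n -> set (measurableTypeR R), (forall i, measurable (A i)) ->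
    m1 [set t | forall i, A i (tnth t i)] = m2 [set t | forall i, A i (tnth t i)]) ->
  forall B, measurable B -> m1 B = m2 B.
Proof.
move=> mE B mB.
pose G : set (set (n.-tuple (measurableTypeR R))) :=
  [set C | exists2 A : 'I_n -> set (measurableTypeR R), (forall i, measurable (A i)) &
    C = [set t | forall i, A i (tnth t i)]].
have GT : G setT.
  by exists (fun=> setT) => //; apply/seteqP.
apply: (@g_sigma_algebra_measure_unique _ _ _ G _ (fun=> setT)) => //.
- by move=> C [A mA ->]; exact: measurable_tuple_box.
- by rewrite bigcup_const//; exists 0%N.
- move=> C D [A mA ->] [A' mA' ->]; exists (fun i => A i `&` A' i).
    by move=> i; exact: measurableI.
  by apply/seteqP; split=> t /= => [[h1 h2] i|h]; [|split=> i; case: (h i)].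
- by move=> C [A mA ->]; exact: mE.
- by move=> _; apply: le_lt_trans (probability_le1 m1 measurableT) _; rewrite ltry.
(* Boxes generate the whole sigma-algebra: a coordinate preimage is the box with all other sides
   full, so the identity from the sigma-algebra generated by boxes is measurable. *)
have mid : measurable_fun [set: g_sigma_algebraType G]
    (fun t : g_sigma_algebraType G => t : n.-tuple (measurableTypeR R)).
  apply/measurable_fun_tnthP => i _ Y mY; rewrite setTI.
  apply: sub_sigma_algebra; exists (fun j => if j == i then Y else setT).
    by move=> j; case: ifP.
  apply/seteqP; split=> t /=; last by move=> /(_ i); rewrite eqxx.
  by move=> tY j; case: ifPn => [/eqP ->|].
by have := mid measurableT B mB; rewrite setTI.
Qed.

Lemma iid_law_tuple (R : realType) disp (T : measurableType disp)
    (P : probability T R) n (X : 'I_n -> {RV P >-> R})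
    (nu : probability (measurableTypeR R) R)
    (g : n.-tuple (measurableTypeR R) -> \bar R) :
  iid_with_law X nu -> measurable_fun setT g -> (forall t, 0 <= g t)%E ->
  (\int[P]_w g [tuple X i w | i < n] = \int[iid_power nu n]_t g t)%E.
Proof.
move=> [Xi Xnu] mg g0.
pose f w : n.-tuple (measurableTypeR R) := [tuple X i w | i < n].
have mf : measurable_fun setT f.
  apply/measurable_fun_tnthP => i.
  rewrite (_ : _ \o _ = X i); first exact: (@measurable_funP _ _ _ _ _ (X i)).
  by apply/funext => w /=; rewrite tnth_mktuple.
pose F : {mfun T >-> n.-tuple (measurableTypeR R)} :=
  HB.pack f (isMeasurableFun.Build _ _ _ _ f mf).
transitivity (\int[distribution P F]_t g t)%E.
  by rewrite ge0_integral_distribution.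
apply: eq_measure_integral => B mB _; apply: tuple_measure_unique => // A mA.
rewrite iid_power_box//.
transitivity (P (\bigcap_(i in [set` [set: 'I_n]%SET]) X i @^-1` A i)).
  rewrite -[LHS]/(P (f @^-1` _)); congr (P _).
  apply/seteqP; split => w /=.
    by move=> h i _; have := h i; rewrite tnth_mktuple.
  by move=> h i; rewrite tnth_mktuple; apply: h; rewrite /= inE.
etransitivity; first exact: (Xi [set: 'I_n]%SET A mA).
under eq_bigl do rewrite inE.
by apply: eq_bigr => i _; exact: (Xnu i (A i) (mA i)).
Qed.

Section averaging.
Variables (R : realType) (d : nat).
Implicit Types (mu nu : probability (measurableTypeR R) R).
Implicit Types (f g : 'cV[R]_d -> R) (w x : 'cV[R]_d).

(** Measurability is expressed through composition with coordinatewise measurable maps, so that no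
    sigma-algebra on column vectors has to be fixed and closure under [avg] follows from Tonelli's
    theorem. *)
Definition test_fun f := (forall x, 0 <= f x <= 1) /\
  forall disp (T : measurableType disp) (g : T -> 'cV[R]_d),
    (forall i, measurable_fun setT (fun t => g t i 0)) ->
    measurable_fun setT (f \o g).

(** Convolution with the law of [y *: w], for [y] distributed as [mu]. Iterating it over a list of
    directions gives the expectation of [f] at a sum of independent terms. *)
Definition avg mu w f : 'cV[R]_d -> R :=
  fun x => fine (\int[mu]_y (f (x + y *: w))%:E)%E.

Definition avgs mu (ws : seq 'cV[R]_d) f := foldr (avg mu) f ws.

Lemma test_fun_measurable f disp (T : measurableType disp) (g : T -> 'cV[R]_d) :
  test_fun f -> (forall i, measurable_fun setT (fun t => g t i 0)) ->
  measurable_fun setT (fun t => (f (g t))%:E).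
Proof. by move=> [_ mf] mg; apply/measurable_EFinP; exact: mf. Qed.

Lemma measurable_line x w i :
  measurable_fun setT (fun y : measurableTypeR R => (x + y *: w) i 0).
Proof.
rewrite (_ : (fun _ => _) = (fun y => x i 0 + y * w i 0)); last first.
  by apply/funext => y; rewrite !mxE.
by apply: measurable_funD => //; apply: measurable_funM.
Qed.

Lemma integral_cst1 mu : (\int[mu]_y (cst 1 y) = 1)%E.
Proof. by rewrite integral_cst// mul1e; exact: probability_setT. Qed.

Lemma avgE mu w f x : test_fun f ->
  (avg mu w f x)%:E = (\int[mu]_y (f (x + y *: w))%:E)%E.
Proof.
move=> tf; rewrite /avg fineK// ge0_fin_numE; last first.
  by apply: integral_ge0 => y _; rewrite lee_fin; case/andP: (tf.1 (x + y *: w)).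
apply: le_lt_trans (_ : (\int[mu]_y (cst 1 y) < +oo)%E); last first.
  by rewrite integral_cst1 ltry.
apply: ge0_le_integral => //=.
- by move=> y _; rewrite lee_fin; case/andP: (tf.1 (x + y *: w)).
- by apply: test_fun_measurable => // i; exact: measurable_line.
- by move=> y _; rewrite lee_fin; case/andP: (tf.1 (x + y *: w)).
Qed.

Lemma avg_test_fun mu w f : test_fun f -> test_fun (avg mu w f).
Proof.
move=> tf; split => [x|disp T g mg].
  rewrite -!lee_fin avgE//; apply/andP; split.
    by apply: integral_ge0 => y _; rewrite lee_fin; case/andP: (tf.1 (x + y *: w)).
  apply: le_trans (_ : (\int[mu]_y (cst 1 y) <= _)%E); last first.
    by rewrite integral_cst1.
  apply: ge0_le_integral => //=.
  - by move=> y _; rewrite lee_fin; case/andP: (tf.1 (x + y *: w)).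
  - by apply: test_fun_measurable => // i; exact: measurable_line.
  - by move=> y _; rewrite lee_fin; case/andP: (tf.1 (x + y *: w)).
apply/measurable_EFinP.
rewrite (_ : EFin \o _ = fubini_F mu
    (fun z : T * measurableTypeR R => (f (g z.1 + z.2 *: w))%:E)); last first.
  by apply/funext => t; rewrite /= avgE.
apply: measurable_fun_fubini_tonelli_F => /=.
  apply: test_fun_measurable => // i.
  rewrite (_ : (fun _ => _) = (fun z : T * measurableTypeR R => g z.1 i 0 + z.2 * w i 0)); last first.
    by apply/funext => y; rewrite !mxE.
  apply: measurable_funD; first exact: (measurableT_comp (mg i)).
  by apply: measurable_funM.
by move=> z; rewrite lee_fin; case/andP: (tf.1 (g z.1 + z.2 *: w)).
Qed.

Lemma avgs_test_fun mu ws f : test_fun f -> test_fun (avgs mu ws f).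
Proof. by move=> tf; elim: ws => //= w ws IH; exact: avg_test_fun. Qed.

Lemma measurable_plane x w w' i :
  measurable_fun setT (fun z : measurableTypeR R * measurableTypeR R =>
    (x + z.1 *: w + z.2 *: w') i 0).
Proof.
rewrite (_ : (fun _ => _) = (fun z => x i 0 + z.1 * w i 0 + z.2 * w' i 0)); last first.
  by apply/funext => y; rewrite !mxE.
by apply: measurable_funD => //; [apply: measurable_funD => //|];
  apply: measurable_funM.
Qed.

Lemma avg_comm mu nu w w' f : test_fun f ->
  avg mu w (avg nu w' f) = avg nu w' (avg mu w f).
Proof.
move=> tf; apply/funext => x; apply/EFin_inj.
rewrite !avgE; [|exact: avg_test_fun..].
under eq_integral do rewrite avgE//.
under [RHS]eq_integral do rewrite avgE//.
have mf : measurable_fun setT (fun z : measurableTypeR R * measurableTypeR R =>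
    (f (x + z.1 *: w + z.2 *: w'))%:E).
  by apply: test_fun_measurable => // i; exact: measurable_plane.
have f0 (z : measurableTypeR R * measurableTypeR R) :
    (0 <= (f (x + z.1 *: w + z.2 *: w'))%:E)%E.
  by rewrite lee_fin; case/andP: (tf.1 (x + z.1 *: w + z.2 *: w')).
etransitivity; first exact: (@fubini_tonelli _ _ _ _ _ mu nu _ mf f0).
apply: eq_integral => z _; apply: eq_integral => y _ /=.
by rewrite addrAC.
Qed.

Lemma avgs_comm mu nu w ws f : test_fun f ->
  avg mu w (avgs nu ws f) = avgs nu ws (avg mu w f).
Proof.
move=> tf; elim: ws => //= w' ws <-.
by apply: avg_comm; exact: avgs_test_fun.
Qed.

Lemma avg_near mu w f g (e : R) : test_fun f -> test_fun g ->
  (forall x, `|f x - g x| <= e) -> forall x, `|avg mu w f x - avg mu w g x| <= e.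
Proof.
move=> tf tg fg x.
have intf h : test_fun h -> mu.-integrable setT (fun y => (h (x + y *: w))%:E).
  move=> th; apply/integrableP; split.
    by apply: test_fun_measurable => // i; exact: measurable_line.
  rewrite (eq_integral (fun y : measurableTypeR R => (h (x + y *: w))%:E)).
    by rewrite -avgE// ltry.
  by move=> y _; rewrite gee0_abs// lee_fin; case/andP: (th.1 (x + y *: w)).
have -> : avg mu w f x - avg mu w g x =
    \int[mu]_y (f (x + y *: w) - g (x + y *: w)).
  by rewrite RintegralB//; exact: intf.
have intB : mu.-integrable setT
    (EFin \o (fun y => f (x + y *: w) - g (x + y *: w))).
  exact: (integrableB measurableT (intf _ tf) (intf _ tg)).
rewrite (le_trans (le_normr_Rintegral _ intB))//.
rewrite -[leRHS]mulr1 -[X in _ * X](_ : fine (mu setT) = 1); last first.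
  by rewrite probability_setT.
rewrite -Rintegral_cst//; apply: le_Rintegral => //.
  exact: (integrable_norm intB).
exact: finite_measure_integrable_cst.
Qed.

Lemma avgs_near mu ws f g (e : R) : test_fun f -> test_fun g ->
  (forall x, `|f x - g x| <= e) -> forall x, `|avgs mu ws f x - avgs mu ws g x| <= e.
Proof.
move=> tf tg fg; elim: ws => //= w ws IH x.
by apply: avg_near => //; exact: avgs_test_fun.
Qed.

(** Telescoping over the list. The tail is exchanged under one more average, which cannot increase a
    uniform distance; for the head, commutation brings its average next to [f], so that the one-term
    hypothesis applies and the remaining averages again preserve the bound. *)
Lemma lindeberg_swap mu nu (F : 'cV[R]_d -> 'cV[R]_d) (D : 'cV[R]_d -> R) ws f :
  test_fun f ->
  (forall w, w \in ws -> forall x, `|avg mu w f x - avg nu (F w) f x| <= D w) ->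
  forall x, `|avgs mu ws f x - avgs nu (map F ws) f x| <= \sum_(w <- ws) D w.
Proof.
move=> tf; elim: ws => [_ x|w ws IH wD x].
  by rewrite big_nil subrr normr0.
rewrite big_cons [D w + _]addrC.
rewrite (le_trans (ler_distD (avg mu w (avgs nu (map F ws) f) x) _ _))// lerD//.
  apply: avg_near; [exact: avgs_test_fun..|] => y; apply: IH => w' w's.
  by apply: wD; rewrite inE w's orbT.
rewrite /= !avgs_comm//; apply: avgs_near; [exact: avg_test_fun..|].
by move=> y; apply: wD; rewrite mem_head.
Qed.

Lemma integral_avgs mu n (ws : n.-tuple 'cV[R]_d) f x : test_fun f ->
  (\int[iid_power mu n]_t (f (x + \sum_(i < n) tnth t i *: tnth ws i))%:E =
   (avgs mu ws f x)%:E)%E.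
Proof.
move=> tf.
have mS m (us : m.-tuple 'cV[R]_d) y : measurable_fun setT
    (fun t : m.-tuple (measurableTypeR R) =>
      (f (y + \sum_(i < m) tnth t i *: tnth us i))%:E).
  apply: test_fun_measurable => // j.
  rewrite (_ : (fun _ => _) = (fun t : m.-tuple (measurableTypeR R) =>
      y j 0 + \sum_(i < m) tnth t i * tnth us i j 0)); last first.
    apply/funext => t; rewrite !mxE summxE; congr (_ + _).
    by apply: eq_bigr => i _; rewrite mxE.
  apply: measurable_funD => //; apply: measurable_sum => i.
  by apply: measurable_funM => //; exact: measurable_tnth.
have f0 y : (0 <= (f y)%:E)%E by rewrite lee_fin; case/andP: (tf.1 y).
elim: n ws x => [|n IH] ws x.
  rewrite integral_dirac// ?diracE ?in_setT ?mul1e; last exact: mS.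
  by rewrite big_ord0 addr0 tuple0.
case/tupleP: ws => w ws; have mws := mS _ [tuple of w :: ws] x.
rewrite ge0_integral_iid_power//.
rewrite avgE; last exact: avgs_test_fun.
apply: eq_integral => y _; rewrite -IH; apply: eq_integral => t _.
congr ((f _)%:E); rewrite big_ord_recl /= addrA; congr (_ + _).
by apply: eq_bigr => i _; rewrite !tnthS.
Qed.

End averaging.

(** * Rotation invariance of Gaussian averages *)

Section density.
Context d (T : measurableType d) (R : realType).
Variables (mu nu : {measure set T -> \bar R}) (g : T -> R).
Hypotheses (mg : measurable_fun setT g) (g0 : forall x, 0 <= g x).
Hypothesis nuE : forall A, measurable A -> nu A = (\int[mu]_(x in A) (g x)%:E)%E.
Local Open Scope ereal_scope.
Import HBNNSimple.

Lemma ge0_integral_density (f : T -> \bar R) : measurable_fun setT f ->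
  (forall x, 0 <= f x) -> \int[nu]_x f x = \int[mu]_x (f x * (g x)%:E).
Proof.
move=> mf f0; pose f_ := nnsfun_approx measurableT mf.
have fcvg x : (EFin \o f_ ^~ x) @ \oo --> f x by exact: cvg_nnsfun_approx.
have fnd x : {homo (fun n => (f_ n x)%:E) : m n / (m <= n)%N >-> m <= n}.
  by move=> m n mn; rewrite lee_fin; exact/lefP/nd_nnsfun_approx.
transitivity (limn (fun n => \int[nu]_x (f_ n x)%:E)).
  rewrite -monotone_convergence//.
  - by apply: eq_integral => x _; apply/esym/cvg_lim => //; exact: fcvg.
  - by move=> n; exact/measurable_EFinP/measurable_funP.
  - by move=> n x _; rewrite lee_fin.
transitivity (limn (fun n => \int[mu]_x ((f_ n x)%:E * (g x)%:E))); last first.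
  rewrite -monotone_convergence//.
  - apply: eq_integral => x _; apply/cvg_lim => //.
    by apply: cvgeZr => //; exact: fcvg.
  - move=> n; apply: emeasurable_funM; last exact/measurable_EFinP.
    exact/measurable_EFinP/measurable_funP.
  - by move=> n x _; rewrite mule_ge0// lee_fin.
  - by move=> x _ m n mn; rewrite lee_wpmul2r ?lee_fin//; exact: fnd.
congr (lim (_ @ \oo)); apply/funext => n.
have mfn r : measurable (f_ n @^-1` [set r]) by [].
transitivity (\sum_(k \in range (f_ n)) \int[nu]_x (k * \1_(f_ n @^-1` [set k]) x)%:E).
  under eq_integral do rewrite fimfunE -fsumEFin//.
  rewrite ge0_integral_fsum//.
  - by move=> r; exact/measurable_EFinP/measurable_funM.
  - by move=> r x _; rewrite nnfun_muleindic_ge0.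
transitivity (\sum_(k \in range (f_ n))
    \int[mu]_x ((k * \1_(f_ n @^-1` [set k]) x)%:E * (g x)%:E)).
  apply: eq_fsbigr => r /[!inE] -[y _ yr].
  have r0 : (0 <= r)%R by rewrite -yr.
  under eq_integral do rewrite EFinM.
  under [RHS]eq_integral do rewrite EFinM -muleA.
  rewrite !ge0_integralZl//; [|..].
  - rewrite integral_indic// setIT nuE// integral_mkcond.
    congr (_ * _); apply: eq_integral => x _; rewrite patchE indicE.
    by case: ifP => _; rewrite ?mul1e ?mul0e.
  - apply: emeasurable_funM; last exact/measurable_EFinP.
    by apply/measurable_EFinP; exact: measurable_indic.
  - by move=> x _; rewrite mule_ge0 ?lee_fin// indicE.
  - by apply/measurable_EFinP; exact: measurable_indic.
rewrite -ge0_integral_fsum//.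
- apply: eq_integral => x _; rewrite -ge0_mule_fsuml; last first.
    by move=> r; rewrite nnfun_muleindic_ge0.
  by rewrite fsumEFin// -fimfunE.
- move=> r; apply: emeasurable_funM; last exact/measurable_EFinP.
  exact/measurable_EFinP/measurable_funM.
- by move=> r x _; rewrite mule_ge0 ?lee_fin// -lee_fin nnfun_muleindic_ge0.
Qed.

End density.

Section gaussian_plane.
Context (R : realType).
Local Notation leb := (@lebesgue_measure R).
Local Notation RR := (measurableTypeR R).
Local Notation gauss := (normal_prob 0 1 : probability (measurableTypeR R) R).
Local Open Scope ereal_scope.

(** Lebesgue measure is characterized by its values on half-open intervals, and its translate has
    the same values there. *)
Lemma ge0_integral_shift (c : R) (f : RR -> \bar R) : measurable_fun setT f ->
  (forall x, 0 <= f x) -> \int[leb]_x f (x + c)%R = \int[leb]_x f x.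
Proof.
move=> mf f0.
have mshift : measurable_fun setT ((fun x : R => (x + c)%R) : RR -> RR).
  by apply: measurable_funD.
pose F : {mfun RR >-> RR} := HB.pack ((fun x : R => (x + c)%R) : RR -> RR)
  (isMeasurableFun.Build _ _ _ _ _ mshift).
transitivity (\int[pushforward leb F]_x f x).
  by rewrite ge0_integral_pushforward.
apply/esym/eq_measure_integral => A mA _.
apply: lebesgue_measure_unique => //= _ [[a b]] _ <-.
rewrite /pushforward/=.
rewrite (_ : _ @^-1` _ = `](a - c)%R, (b - c)%R]%classic); last first.
  by apply/seteqP; split => x /=; rewrite !in_itv/= lerBrDr ltrBlDr.
rewrite !lebesgue_measure_itv/= !lte_fin ltrD2r.
by case: ifP => // _; rewrite -!EFinD; congr (_%:E); ring.
Qed.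

Lemma integral_shear2 (a : R) (H : RR * RR -> \bar R) : measurable_fun setT H ->
  (forall z, 0 <= H z) ->
  \int[leb]_x \int[leb]_y H (x, y + a * x)%R = \int[leb]_x \int[leb]_y H (x, y).
Proof.
move=> mH H0; apply: eq_integral => x _.
apply: (@ge0_integral_shift (a * x)%R (fun y => H (x, y))) => // .
exact: (measurableT_comp mH (pair1_measurable x)).
Qed.

Lemma integral_shear1 (b : R) (H : RR * RR -> \bar R) : measurable_fun setT H ->
  (forall z, 0 <= H z) ->
  \int[leb]_x \int[leb]_y H (x + b * y, y)%R = \int[leb]_x \int[leb]_y H (x, y).
Proof.
move=> mH H0.
have mH' : measurable_fun setT (fun z : RR * RR => H (z.1 + b * z.2, z.2)%R).
  apply: (measurableT_comp mH); apply: measurable_fun_pair => //.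
  by apply: measurable_funD => //; apply: measurable_funM.
rewrite (fubini_tonelli _ mH' (fun z => H0 _)) (fubini_tonelli _ mH H0)/=.
apply: eq_integral => y _.
apply: (@ge0_integral_shift (b * y)%R (fun x => H (x, y))) => // .
exact: (measurableT_comp mH (pair2_measurable y)).
Qed.

(* A rotation of angle different from pi is a product of three shears. *)
Lemma integral_rotation (c s : R) (H : RR * RR -> \bar R) :
  (c ^+ 2 + s ^+ 2 = 1)%R -> (1 + c != 0)%R ->
  measurable_fun setT H -> (forall z, 0 <= H z) ->
  \int[leb]_x \int[leb]_y H (c * x - s * y, s * x + c * y)%R =
  \int[leb]_x \int[leb]_y H (x, y).
Proof.
(* The tangent of half the angle. The rotation is then the first-coordinate shear by [- t], the
   second-coordinate shear by [s], and the first shear again. *)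
move=> cs c1 mH H0; pose t : R := (s / (1 + c))%R.
pose H1 := fun z : RR * RR => H (z.1 + - t * z.2, z.2)%R.
pose H2 := fun z : RR * RR => H1 (z.1, z.2 + s * z.1)%R.
have mH1 : measurable_fun setT H1.
  apply: (measurableT_comp mH); apply: measurable_fun_pair => //.
  by apply: measurable_funD => //; apply: measurable_funM.
have mH2 : measurable_fun setT H2.
  apply: (measurableT_comp mH1); apply: measurable_fun_pair => //.
  by apply: measurable_funD => //; apply: measurable_funM.
rewrite -(integral_shear1 (- t) mH H0) -/H1.
rewrite -(integral_shear2 s mH1 (fun z => H0 _)).
rewrite -(integral_shear1 (- t) mH2 (fun z => H0 _)).
apply: eq_integral => x _; apply: eq_integral => y _.
have ts : (t * s = 1 - c)%R.
  apply: (mulfI c1); rewrite /t mulrA (mulrC _ (s / _)%R) divfK// -expr2.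
  by rewrite -(addrK (c ^+ 2)%R (s ^+ 2)%R) (addrC (s ^+ 2)%R) cs; ring.
have tc : (t * (1 + c) = s)%R by rewrite /t divfK.
rewrite /H2 /H1 /=; congr (H (_, _)).
  transitivity ((1 - t * s) * x - (t * (1 + (1 - t * s))) * y)%R; last by ring.
  by rewrite ts subKr tc.
transitivity (s * x + (1 - t * s) * y)%R; last by ring.
by rewrite ts subKr.
Qed.

Lemma ge0_integral_gauss (f : RR -> \bar R) : measurable_fun setT f ->
  (forall x, 0 <= f x) ->
  \int[gauss]_x f x = \int[leb]_x (f x * (normal_pdf 0 1 x)%:E).
Proof.
move=> mf f0; apply: ge0_integral_density => //.
- exact: measurable_normal_pdf.
- by move=> x; exact: normal_pdf_ge0.
Qed.

Lemma ge0_integral_gauss2 (h : RR * RR -> \bar R) : measurable_fun setT h ->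
  (forall z, 0 <= h z) ->
  \int[gauss]_x \int[gauss]_y h (x, y) = \int[leb]_x \int[leb]_y
    (h (x, y) * (normal_pdf 0 1 x * normal_pdf 0 1 y)%:E).
Proof.
move=> mh h0.
have mhx x : measurable_fun setT (fun y : RR => h (x, y)).
  exact: (measurableT_comp mh (pair1_measurable x)).
rewrite ge0_integral_gauss; last 2 first.
  exact: (@measurable_fun_fubini_tonelli_F _ _ _ _ _ gauss _ mh h0).
  by move=> x; apply: integral_ge0.
apply: eq_integral => x _; rewrite ge0_integral_gauss//.
rewrite -ge0_integralZr//.
- by apply: eq_integral => y _; rewrite EFinM -muleA (muleC (_ x)%:E).
- apply: emeasurable_funM => //; apply/measurable_EFinP.
  exact: measurable_normal_pdf.
- by move=> y _; rewrite mule_ge0 ?lee_fin ?normal_pdf_ge0.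
- by rewrite lee_fin normal_pdf_ge0.
Qed.

(** The product density depends on x and y only through the sum of their squares, which a rotation
    fixes; what remains is the rotation invariance of plane Lebesgue measure. *)
Lemma gauss_rotation_neq (c s : R) (h : RR * RR -> \bar R) :
  (c ^+ 2 + s ^+ 2 = 1)%R -> (1 + c != 0)%R ->
  measurable_fun setT h -> (forall z, 0 <= h z) ->
  \int[gauss]_x \int[gauss]_y h (c * x - s * y, s * x + c * y)%R =
  \int[gauss]_x \int[gauss]_y h (x, y).
Proof.
move=> cs c1 mh h0; rewrite [RHS]ge0_integral_gauss2//.
pose H := fun z : RR * RR => h z * (normal_pdf 0 1 z.1 * normal_pdf 0 1 z.2)%:E.
have mH : measurable_fun setT H.
  apply: emeasurable_funM => //; apply/measurable_EFinP.
  by apply: measurable_funM; apply: (measurableT_comp (measurable_normal_pdf _ _)).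
have H0 z : 0 <= H z by rewrite mule_ge0// lee_fin mulr_ge0// normal_pdf_ge0.
have mh' : measurable_fun setT (fun z : RR * RR => h (c * z.1 - s * z.2, s * z.1 + c * z.2)%R).
  apply: (measurableT_comp mh); apply: measurable_fun_pair.
    by apply: measurable_funB; apply: measurable_funM.
  by apply: measurable_funD; apply: measurable_funM.
rewrite -[RHS](integral_rotation cs c1 mH H0).
rewrite (ge0_integral_gauss2 mh' (fun z => h0 _)).
apply: eq_integral => x _; apply: eq_integral => y _; rewrite /H/=.
congr (_ * _%:E); rewrite !normal_pdfE ?oner_eq0//.
rewrite mulrACA [RHS]mulrACA; congr (_ * _)%R.
rewrite /normal_fun -!expRD; congr (expR _).
rewrite !subr0 expr1n -!mulrDl; congr (_ / _)%R.
transitivity (- ((c ^+ 2 + s ^+ 2) * (x ^+ 2 + y ^+ 2)))%R; last by ring.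
by rewrite cs; ring.
Qed.

Lemma gauss_rotation (c s : R) (h : RR * RR -> \bar R) :
  (c ^+ 2 + s ^+ 2 = 1)%R ->
  measurable_fun setT h -> (forall z, 0 <= h z) ->
  \int[gauss]_x \int[gauss]_y h (c * x - s * y, s * x + c * y)%R =
  \int[gauss]_x \int[gauss]_y h (x, y).
Proof.
move=> cs mh h0; have [c1|c1] := eqVneq (1 + c)%R 0%R; last exact: gauss_rotation_neq.
have cE : (c = -1)%R by apply/eqP; rewrite -addr_eq0 addrC c1.
have sE : (s = 0)%R.
  move: cs; rewrite cE sqrrN expr1n => /(canRL (addKr _)).
  by rewrite addrC subrr => /eqP; rewrite sqrf_eq0 => /eqP.
(* The half-turn, which the half-angle tangent cannot reach, is performed as two quarter-turns. *)
have q2 : ((0:R) ^+ 2 + 1 ^+ 2 = 1)%R by rewrite expr0n expr1n add0r.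
have q1 : (1 + (0:R) != 0)%R by rewrite addr0 oner_eq0.
rewrite -[RHS](gauss_rotation_neq q2 q1 mh h0).
have mh' : measurable_fun setT (fun z : RR * RR => h (0 * z.1 - 1 * z.2, 1 * z.1 + 0 * z.2)%R).
  apply: (measurableT_comp mh); apply: measurable_fun_pair.
    by apply: measurable_funB; apply: measurable_funM.
  by apply: measurable_funD; apply: measurable_funM.
rewrite -[RHS](gauss_rotation_neq q2 q1 mh' (fun z => h0 _)).
apply: eq_integral => x _; apply: eq_integral => y _ /=.
by congr (h (_, _)); rewrite cE sE; ring.
Qed.

End gaussian_plane.

Section gaussian_averages.
Variables (R : realType) (d : nat).
Variable gauss : probability (measurableTypeR R) R.
Hypothesis gauss_rot : forall (c s : R)
    (h : measurableTypeR R * measurableTypeR R -> \bar R),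
  c ^+ 2 + s ^+ 2 = 1 -> measurable_fun setT h -> (forall z, 0 <= h z)%E ->
  (\int[gauss]_x \int[gauss]_y h (c * x - s * y, s * x + c * y)%R =
   \int[gauss]_x \int[gauss]_y h (x, y))%E.
Implicit Types (f : 'cV[R]_d -> R) (u v w x : 'cV[R]_d).

(** Rotating the two directions has the same effect as rotating the two independent variables that
    multiply them, so the assumed invariance of the product law applies. *)
Lemma avg_rotation (c s : R) u v f : test_fun f -> c ^+ 2 + s ^+ 2 = 1 ->
  avg gauss (c *: u + s *: v) (avg gauss (c *: v - s *: u) f) =
  avg gauss u (avg gauss v f).
Proof.
move=> tf cs; apply/funext => x; apply/EFin_inj.
rewrite [LHS]avgE; last exact: avg_test_fun.
rewrite [RHS]avgE; last exact: avg_test_fun.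
under eq_integral do rewrite avgE//.
under [RHS]eq_integral do rewrite avgE//.
pose h (z : measurableTypeR R * measurableTypeR R) :=
  (f (x + z.1 *: u + z.2 *: v))%:E.
have mh : measurable_fun setT h.
  by apply: test_fun_measurable => // i; exact: measurable_plane.
have h0 z : (0 <= h z)%E.
  by rewrite lee_fin; case/andP: (tf.1 (x + z.1 *: u + z.2 *: v)).
etransitivity; last exact: (gauss_rot cs mh h0).
apply: eq_integral => y _; apply: eq_integral => z _.
rewrite /h /=; congr ((f _)%:E); apply/colP => i; rewrite !mxE.
by ring.
Qed.

Definition outer_sum (ws : seq 'cV[R]_d) : 'M[R]_d := \sum_(w <- ws) w *m w^T.

Lemma outer_sumE ws i j : outer_sum ws i j = \sum_(w <- ws) w i 0 * w j 0.
Proof.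
rewrite /outer_sum summxE; apply: eq_bigr => w _.
by rewrite mxE big_ord1 !mxE.
Qed.

Lemma outer_sum_cons w ws : outer_sum (w :: ws) = w *m w^T + outer_sum ws.
Proof. by rewrite /outer_sum big_cons. Qed.

Lemma avg_zero f : test_fun f -> avg gauss 0 f = f.
Proof.
move=> tf; apply/funext => x /=; apply/EFin_inj; rewrite avgE//.
under eq_integral do rewrite scaler0 addr0.
by rewrite integral_cst//= [X in (_ * X)%E](@probability_setT _ _ _ gauss) mule1.
Qed.

(* Plane rotations applied successively clear the coordinate [i] of all vectors
   but one, preserving the Gaussian average and the matrix of second moments. *)
Lemma givens (i : 'I_d) (ws : seq 'cV[R]_d) : exists w0 ws',
  [/\ forall f, test_fun f -> avgs gauss (w0 :: ws') f = avgs gauss ws f,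
      outer_sum (w0 :: ws') = outer_sum ws,
      0 <= w0 i 0 & forall w, w \in ws' -> w i 0 = 0].
Proof.
elim: ws => [|u us [w0 [us' [avgsE sumE w0i us'0]]]].
  exists 0, [::]; split=> //; last by rewrite mxE.
    by move=> f tf; exact: avg_zero.
  by rewrite outer_sum_cons mul0mx add0r.
have [c [s [cs rge r0]]] : exists c s : R, [/\ c ^+ 2 + s ^+ 2 = 1,
    0 <= c * u i 0 + s * w0 i 0 & c * w0 i 0 - s * u i 0 = 0].
  (* The rotation points along (u_i, w0_i), normalized by its length r. If r = 0 there is no such
     direction, but both coordinates vanish and the quarter-turn 0, 1 keeps the pivot
     nonnegative. *)
  have [r0|r0] := eqVneq (Num.sqrt (u i 0 ^+ 2 + w0 i 0 ^+ 2)) 0.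
    have : u i 0 ^+ 2 + w0 i 0 ^+ 2 <= 0 by rewrite -sqrtr_eq0 r0.
    rewrite real_leNgt ?num_real// -leNgt => le0.
    have u0 : u i 0 = 0.
      apply/eqP; rewrite -sqrf_eq0 eq_le sqr_ge0 andbT.
      by rewrite (le_trans _ le0)// lerDl sqr_ge0.
    exists 0, 1; rewrite expr0n expr1n add0r mul0r add0r mul1r u0.
    by rewrite mul0r mulr0 subr0.
  set r := Num.sqrt _ in r0.
  have rr : r ^+ 2 = u i 0 ^+ 2 + w0 i 0 ^+ 2.
    by rewrite sqr_sqrtr// addr_ge0// sqr_ge0.
  exists (u i 0 / r), (w0 i 0 / r); split.
  - by rewrite !expr_div_n -mulrDl -rr divff// sqrf_eq0.
  - rewrite mulrAC -expr2 (mulrAC (w0 i 0)) -expr2 -mulrDl -rr.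
    by rewrite divr_ge0 ?sqr_ge0 ?sqrtr_ge0.
  - by field.
exists (c *: u + s *: w0), ((c *: w0 - s *: u) :: us'); split.
- move=> f tf; transitivity (avg gauss u (avgs gauss (w0 :: us') f)).
    exact: (avg_rotation u w0 (avgs_test_fun _ us' tf) cs).
  by rewrite [RHS]/= (avgsE _ tf).
- rewrite !outer_sum_cons -sumE outer_sum_cons !addrA; congr (_ + _).
  apply/matrixP => k l; rewrite !mxE !big_ord1 !mxE.
  transitivity ((c ^+ 2 + s ^+ 2) * (u k 0 * u l 0 + w0 k 0 * w0 l 0)); last first.
    by rewrite cs mul1r.
  by ring.
- by rewrite !mxE.
- by move=> w; rewrite inE => /orP[/eqP ->|/us'0//]; rewrite !mxE.
Qed.

(** After coordinate i has been cleared from all vectors but the pivot, row i of the second-moment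
    matrix involves the pivot alone, and [uniq s] keeps the remaining basis vectors out of that row
    as well. This forces the pivot to be the basis vector, which cancels from both sides. When no
    direction is left, the diagonal of a zero matrix shows that every vector is 0. *)
Lemma avgs_outer_sum (s : seq 'I_d) ws f : test_fun f -> uniq s ->
  outer_sum ws = outer_sum [seq delta_mx i 0 | i <- s] ->
  avgs gauss ws f = avgs gauss [seq delta_mx i 0 | i <- s] f.
Proof.
move=> tf; elim: s ws => [|i s IH] ws /=.
  move=> _ sum0; suff: forall w, w \in ws -> w = 0.
    elim: ws {sum0} => //= w ws IH ws0; rewrite (ws0 w) ?mem_head//.
    rewrite IH; first exact: avg_zero.
    by move=> v vs; apply: ws0; rewrite inE vs orbT.
  move=> w wws; apply/colP => j; rewrite mxE.
  have /eqP : outer_sum ws j j = 0 by rewrite sum0 /outer_sum big_nil mxE.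
  rewrite outer_sumE psumr_eq0; last by move=> v _; rewrite -expr2 sqr_ge0.
  by move=> /allP /(_ w wws); rewrite -expr2 sqrf_eq0 => /eqP.
move=> /andP[iNs us] sumE.
have [w0 [ws' [avgsE sumE' w0i ws'0]]] := givens i ws.
rewrite -avgsE//; move: sumE; rewrite -sumE' !outer_sum_cons => sumE.
have row_i l : w0 i 0 * w0 l 0 = (l == i)%:R.
  have := congr1 (fun M : 'M[R]_d => M i l) sumE.
  rewrite !mxE !outer_sumE !big_ord1 !mxE !eqxx mul1r.
  rewrite !big_seq [X in _ + X = _]big1; last first.
    by move=> w ws'w; rewrite (ws'0 w ws'w) mul0r.
  rewrite [X in _ = _ + X]big1 ?addr0; last first.
    move=> w /mapP[k ks ->]; rewrite !mxE.
    by have [ik|_] := eqVneq i k; rewrite ?mul0r//; rewrite ik ks in iNs.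
  by rewrite andbT.
have w0E : w0 = delta_mx i 0.
  (* The square of the pivot coordinate is 1; the sign recorded by [givens] excludes -1. *)
  have w1 : w0 i 0 = 1.
    apply/eqP; rewrite -(@eqrXn2 _ 2)// expr1n expr2.
    by rewrite row_i eqxx.
  by apply/colP => l; rewrite mxE eqxx andbT -row_i w1 mul1r.
rewrite /= w0E; congr (avg _ _ _); apply: IH => //.
by move: sumE; rewrite w0E => /addrI.
Qed.

End gaussian_averages.

Lemma gaussian_avgs (R : realType) d (ws : seq 'cV[R]_d) f :
  test_fun f -> outer_sum ws = 1%:M ->
  ((avgs (normal_prob 0 1) ws f 0)%:E =
   \int[std_normal R d]_t (f (\col_i tnth t i))%:E)%E.
Proof.
move=> tf sum1; rewrite std_normalE.
move: (normal_prob 0 1 : probability _ R) (@gauss_rotation R) => gauss gauss_rot.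
rewrite (avgs_outer_sum gauss_rot tf (enum_uniq 'I_d)); last first.
  rewrite sum1; apply/matrixP => k l; rewrite outer_sumE big_map big_enum/=.
  rewrite (bigD1 k)//= big1 ?addr0; last first.
    by move=> i ik; rewrite !mxE eq_sym (negbTE ik) mul0r.
  by rewrite !mxE !eqxx mul1r andbT eq_sym.
have -> : [seq delta_mx i 0 | i <- enum 'I_d] =
    [tuple delta_mx i 0 | i < d] :> seq 'cV[R]_d by [].
rewrite -integral_avgs//; apply: eq_integral => t _; congr ((f _)%:E).
rewrite add0r; apply/colP => k; rewrite mxE summxE (bigD1 k)//= big1 ?addr0.
  by rewrite tnth_mktuple !mxE !eqxx mulr1.
by move=> i ik; rewrite tnth_mktuple !mxE eq_sym (negbTE ik) mulr0.
Qed.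

(** * Gaussian moments *)

Section gaussian_moments.
Variable R : realType.
Local Notation gauss := (normal_prob 0 1 : probability (measurableTypeR R) R).
Local Notation leb := (@lebesgue_measure R).
Local Notation pdf := (normal_pdf (0 : R) 1).

Let F (x : R) : R := - (x * pdf x).

Lemma is_derive_normal_pdf (x : R) : is_derive x 1 pdf (- (x * pdf x)).
Proof.
rewrite normal_pdfE ?oner_eq0//.
have -> : (fun x0 => normal_peak 1 * normal_fun 0 1 x0) =
  (fun y : R => normal_peak 1 * expR (- (y ^+ 2 / 2))).
  by apply/funext => y; rewrite /normal_fun subr0 expr1n mulNr.
apply: is_derive_eq.
by rewrite /normal_fun subr0 expr1n mulNr /GRing.scale/=; field.
Qed.

(** Gives the vanishing at infinity of the antiderivative [F]; it is the inequality 1 + t <= exp t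
    at t = x^2/2. *)
Lemma normal_pdf_le (x : R) : 0 < x -> x * pdf x <= 2 * pdf 0 / x.
Proof.
move=> x0; rewrite ler_pdivlMr// normal_pdfE ?oner_eq0// /normal_fun.
rewrite !subr0 expr1n expr0n/= oppr0 mul0r expR0 mulr1.
rewrite mulrAC -expr2 mulrCA -mulrA (mulrC 2) ler_wpM2l ?normal_peak_ge0//.
have : 1 + x ^+ 2 / 2 <= expR (x ^+ 2 / 2) by exact: expR_ge1Dx.
rewrite mulNr expRN => ge1.
by rewrite mulrA ler_pdivrMr ?expR_gt0//; lra.
Qed.

(** The function [F] has derivative (x^2 - 1) pdf and vanishes at 0 and at infinity. The half-line
    is cut at 1, where this derivative changes sign, so that each piece is an identity between
    integrals of nonnegative functions; the boundary terms [pdf 1] of the two pieces then match. *)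
Lemma integral_sqr_pdf_half :
  (\int[leb]_(x in `[0%R, +oo[) (x ^+ 2 * pdf x)%:E =
   \int[leb]_(x in `[0%R, +oo[) (pdf x)%:E)%E.
Proof.
pose f (x : R) := (x ^+ 2 - 1) * pdf x.
have dF (x : R) : is_derive x 1 F (f x).
  have := is_derive_normal_pdf x => ?.
  by apply: is_derive_eq; rewrite /f /GRing.scale/=; ring.
have cpdf : continuous pdf by apply: continuous_normal_pdf; rewrite oner_eq0.
have cf : continuous f.
  move=> x; apply: cvgM; last exact: cpdf.
  by apply: cvgB; [exact: exprn_continuous|exact: cvg_cst].
have cF : continuous F.
  by move=> x; apply: differentiable_continuous; apply/derivable1_diffP.
have I01 : (\int[leb]_(x in `[0%R, 1%R]) (- f x)%:E = (- F 1)%:E - (- F 0)%:E)%E.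
  apply: (@continuous_FTC2 _ (- f) (- F)); first exact: ltr01.
  - by apply: continuous_subspaceT => x; apply: cvgN; exact: cf.
  - split.
    + by move=> x _.
    + by apply: cvg_at_right_filter; apply: cvgN; exact: cF.
    + by apply: cvg_at_left_filter; apply: cvgN; exact: cF.
  - by move=> x _; rewrite derive1E; exact: derive_val.
have I1y : (\int[leb]_(x in `[1%R, +oo[) (f x)%:E = 0%:E - (F 1)%:E)%E.
  apply: ge0_continuous_FTC2y.
  - move=> x x1; rewrite /f mulr_ge0 ?normal_pdf_ge0// subr_ge0.
    by rewrite -(expr1n _ 2) lerXn2r ?nnegrE// (le_trans ler01).
  - exact: continuous_subspaceT.
  - apply/cvgrPdist_le => e e0; near=> x.
    rewrite sub0r opprK ger0_norm; last first.
      by rewrite mulr_ge0 ?normal_pdf_ge0.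
    apply: (le_trans (normal_pdf_le _)) => //.
    rewrite ler_pdivrMr// -ler_pdivrMl//.
  - by move=> x _.
  - by apply: cvg_at_right_filter; exact: cF.
  - by move=> x _; rewrite derive1E; exact: derive_val.
have mf : measurable_fun setT f by exact: continuous_measurable_fun.
have mpdf : measurable_fun setT pdf by exact: measurable_normal_pdf.
have mxpdf : measurable_fun setT (fun x : R => x ^+ 2 * pdf x).
  by apply: measurable_funM.
have split (g : R -> R) : measurable_fun setT g -> (forall x : R, 0 <= g x) ->
    (\int[leb]_(x in `[0%R, +oo[) (g x)%:E =
     \int[leb]_(x in `[0%R, 1%R]) (g x)%:E + \int[leb]_(x in `[1%R, +oo[) (g x)%:E)%E.
  move=> mg g0.
  have -> : `[0%R, +oo[%classic = `[0%R, 1%R]%classic `|` `]1%R, +oo[%classic :> set R.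
    apply/seteqP; split=> x /=; rewrite !in_itv/= !andbT.
      by move=> ->; case: (leP x 1) => _; [left|right].
    by case=> [/andP[]//|/ltW]; exact: le_trans.
  rewrite ge0_integral_setU//=.
  - congr (_ + _)%E; apply: integral_itv_obnd_cbnd.
    exact/measurable_EFinP/measurable_funTS.
  - exact/measurable_EFinP/measurable_funTS.
  - by move=> x _; rewrite lee_fin.
  - apply/disj_setPS => x /= []; rewrite !in_itv/= andbT => /andP[_ x1].
    by rewrite ltNge x1.
have x2pdf0 (x : R) : 0 <= x ^+ 2 * pdf x.
  by rewrite mulr_ge0 ?sqr_ge0 ?normal_pdf_ge0.
rewrite !split//; last by move=> x; exact: normal_pdf_ge0.
have K1 : (\int[leb]_(x in `[0%R, 1%R]) (pdf x)%:E =
    (pdf 1)%:E + \int[leb]_(x in `[0%R, 1%R]) (x ^+ 2 * pdf x)%:E)%E.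
  have -> : ((pdf 1)%:E = \int[leb]_(x in `[0%R, 1%R]) (- f x)%:E)%E.
    by rewrite I01 /F mul1r mul0r !opprK sube0.
  rewrite -ge0_integralD//.
  - apply: eq_integral => x _; rewrite -EFinD; congr (_%:E).
    by rewrite /f; ring.
  - move=> x /=; rewrite in_itv/= => /andP[x0 x1]; rewrite lee_fin.
    rewrite /f -mulNr opprB mulr_ge0 ?normal_pdf_ge0// subr_ge0.
    by rewrite expr_le1.
  - by apply/measurable_EFinP/measurable_funTS; exact: measurableT_comp.
  - by move=> x _; rewrite lee_fin.
  - exact/measurable_EFinP/measurable_funTS.
have J2 : (\int[leb]_(x in `[1%R, +oo[) (x ^+ 2 * pdf x)%:E =
    (pdf 1)%:E + \int[leb]_(x in `[1%R, +oo[) (pdf x)%:E)%E.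
  have -> : ((pdf 1)%:E = \int[leb]_(x in `[1%R, +oo[) (f x)%:E)%E.
    by rewrite I1y /F mul1r sub0e -EFinN opprK.
  rewrite -ge0_integralD//.
  - apply: eq_integral => x _; rewrite -EFinD; congr (_%:E).
    by rewrite /f; ring.
  - move=> x /=; rewrite in_itv/= andbT => x1; rewrite lee_fin.
    rewrite /f mulr_ge0 ?normal_pdf_ge0// subr_ge0.
    by rewrite -(expr1n _ 2) lerXn2r ?nnegrE// (le_trans ler01).
  - exact/measurable_EFinP/measurable_funTS.
  - by move=> x _; rewrite lee_fin normal_pdf_ge0.
  - exact/measurable_EFinP/measurable_funTS.
by rewrite K1 J2 addeCA addeA.
Unshelve. all: by end_near. Qed.

Lemma gauss_second_moment : (\int[gauss]_y (y ^+ 2)%:E = 1)%E.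
Proof.
have cpdf : continuous pdf by apply: continuous_normal_pdf; rewrite oner_eq0.
have pdfN (x : R) : pdf (- x) = pdf x.
  by rewrite normal_pdfE ?oner_eq0// /normal_fun !subr0 sqrrN.
rewrite ge0_integral_gauss; last 2 first.
- by apply/measurable_EFinP; exact: measurable_funX.
- by move=> x; rewrite lee_fin sqr_ge0.
rewrite -[RHS](integral_normal_pdf (0:R) 1).
rewrite (ge0_symfun_integralT (f := pdf)); last 3 first.
- by move=> x; exact: normal_pdf_ge0.
- exact: cpdf.
- by move=> x /=; rewrite pdfN.
under eq_integral do rewrite -EFinM.
rewrite (ge0_symfun_integralT (f := fun x : R => x ^+ 2 * pdf x)); last 3 first.
- by move=> x; rewrite mulr_ge0 ?sqr_ge0 ?normal_pdf_ge0.
- by move=> x; apply: cvgM; [exact: exprn_continuous|exact: cpdf].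
- by move=> x /=; rewrite pdfN sqrrN.
by rewrite -set_itvcy integral_sqr_pdf_half.
Qed.

Lemma gauss_sqr_integrable :
  gauss.-integrable setT (fun y : measurableTypeR R => (y ^+ 2)%:E).
Proof.
apply/integrableP; split; first by apply/measurable_EFinP; exact: measurable_funX.
rewrite (eq_integral (fun y : measurableTypeR R => (y ^+ 2)%:E)).
  by rewrite gauss_second_moment ltry.
by move=> y _; rewrite gee0_abs// lee_fin sqr_ge0.
Qed.

End gaussian_moments.

Lemma sqr_integrable_id (R : realType) (mu : probability (measurableTypeR R) R) :
  mu.-integrable setT (fun y : measurableTypeR R => (y ^+ 2)%:E) ->
  mu.-integrable setT (fun y : measurableTypeR R => y%:E).
Proof.
move=> int2; apply: (@le_integrable _ _ _ mu setT measurableT _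
  (fun y : measurableTypeR R => (1 + y ^+ 2)%:E)).
- by apply/measurable_EFinP.
- move=> y _ /=; rewrite lee_fin [leRHS]ger0_norm ?addr_ge0 ?sqr_ge0//.
  rewrite -(real_normK (num_real y)).
  by have := sqr_ge0 (`|y| - 1); nra.
- have int0 : mu.-integrable setT (fun=> 1%:E : \bar R).
    exact: finite_measure_integrable_cst.
  exact: (integrableD measurableT int0 int2).
Qed.

(** The half-turn exchanges the positive and negative parts of the first coordinate, so their
    integrals agree. Integrability, known from the second moment, makes the difference of the two
    meaningful. *)
Lemma gauss_mean (R : realType) :
  (\int[(normal_prob 0 1 : probability (measurableTypeR R) R)]_y y%:E = 0)%E.
Proof.
have int1 := sqr_integrable_id (@gauss_sqr_integrable R).
move: int1 (@gauss_rotation R).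
move: (normal_prob 0 1 : probability (measurableTypeR R) R) => mu int1 mu_rot.
pose h (z : measurableTypeR R * measurableTypeR R) := (Num.max z.1 0)%:E.
have mh : measurable_fun setT h.
  by apply/measurable_EFinP; exact: measurable_funrpos.
have h0 z : (0 <= h z)%E by rewrite lee_fin le_max lexx orbT.
have cs : ((-1 : R) ^+ 2 + 0 ^+ 2 = 1) by rewrite sqrrN expr1n expr0n addr0.
have cstI (g : R -> \bar R) : (\int[mu]_x \int[mu]_y g x = \int[mu]_x g x)%E.
  apply: eq_integral => x _.
  by rewrite integral_cst//= [X in (_ * X)%E](@probability_setT _ _ _ mu) mule1.
have posneg : (\int[mu]_x (Num.max (- x) 0)%:E = \int[mu]_x (Num.max x 0)%:E)%E.
  rewrite -[RHS]cstI -[LHS]cstI; rewrite -[RHS](mu_rot _ _ h cs mh h0).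
  apply: eq_integral => x _; apply: eq_integral => y _; rewrite /h /=.
  by rewrite mulN1r mul0r subr0.
rewrite integralE.
have posE : ((fun y : measurableTypeR R => y%:E) ^\+)%E =
    (fun y : measurableTypeR R => (Num.max y 0)%:E).
  by apply/funext => y; rewrite funeposE -EFin_max.
have negE : ((fun y : measurableTypeR R => y%:E) ^\-)%E =
    (fun y : measurableTypeR R => (Num.max (- y) 0)%:E).
  by apply/funext => y; rewrite funenegE -EFinN -EFin_max.
rewrite posE negE posneg subee// -posE.
exact: integrable_pos_fin_num.
Qed.

(** * Smooth approximation of orthants *)

Section smooth_step.
Variable R : realType.
Implicit Types x h z t : R.

Definition cube_pos x : R := Num.max x 0 ^+ 3.

(** Away from 0 the third derivative of [cube_pos] is 0 or 6, which gives a remainder of at most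
    |h|^3; the four sign patterns of [x] and [x + h] make it explicit. *)
Lemma cube_pos_taylor x h :
  `|cube_pos (x + h) - (cube_pos x + 3 * Num.max x 0 ^+ 2 * h
    + 3 * Num.max x 0 * h ^+ 2)| <= `|h| ^+ 3.
Proof.
rewrite /cube_pos; have [x0|x0] := leP x 0; have [xh|xh] := leP (x + h) 0.
- by rewrite (_ : _ - _ = 0) ?normr0 ?exprn_ge0//; ring.
- have h0 : 0 <= h by lra.
  rewrite (_ : _ - _ = (x + h) ^+ 3); last by ring.
  have xh0 := ltW xh.
  by rewrite (ger0_norm h0) ger0_norm ?exprn_ge0// lerXn2r ?nnegrE//; lra.
- have h0 : h <= 0 by lra.
  rewrite (_ : _ - _ = h ^+ 3 - (x + h) ^+ 3); last by ring.
  rewrite (ler0_norm h0).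
  have h3 : (- (x + h)) ^+ 3 <= (- h) ^+ 3 by rewrite lerXn2r ?nnegrE//; lra.
  have xh3 : 0 <= (- (x + h)) ^+ 3 by rewrite exprn_ge0//; lra.
  by rewrite ler_norml; apply/andP; split; lra.
- by rewrite (_ : _ - _ = h ^+ 3) ?normrX//; ring.
Qed.

(* The third difference of the cubic spline [cube_pos]: a twice continuously
   differentiable step from 0 on the negatives to 1 beyond 3. *)
Definition smooth_step x : R :=
  (cube_pos x - 3 * cube_pos (x - 1) + 3 * cube_pos (x - 2) - cube_pos (x - 3)) / 6.

Lemma smooth_step_bounds x : 0 <= smooth_step x <= 1.
Proof.
rewrite /smooth_step /cube_pos.
have [x0|x0] := leP x 0; have [x1|x1] := leP (x - 1) 0;
  have [x2|x2] := leP (x - 2) 0; have [x3|x3] := leP (x - 3) 0; try lra.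
(* Three sign patterns survive, for x in ]0,1], ]1,2] and ]2,3]. The step is x^3/6 on the first, a
   cubic in y = x - 1 on the second, and 1 - (3 - x)^3/6 on the third. *)
- have h : 0 <= x ^+ 3 <= 1.
    by have x0' := ltW x0; rewrite exprn_ge0//= exprn_ile1//; lra.
  by lra.
- have [y [-> y0 y1]] : exists y, [/\ x = 1 + y, 0 <= y & y <= 1].
    by exists (x - 1); split; lra.
  apply/andP; split; nra.
- have h : 0 <= (3 - x) ^+ 3 <= 1.
    by rewrite exprn_ge0 ?exprn_ile1//; lra.
  by lra.
Qed.

Lemma smooth_step_le0 x : x <= 0 -> smooth_step x = 0.
Proof.
move=> x0; rewrite /smooth_step /cube_pos !(max_idPr _); [by ring|lra..].
Qed.

Lemma smooth_step_ge3 x : 3 <= x -> smooth_step x = 1.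
Proof.
move=> x0; rewrite /smooth_step /cube_pos !(max_idPl _); [by field|lra..].
Qed.

Lemma measurable_smooth_step : measurable_fun setT smooth_step.
Proof.
have mc c : measurable_fun setT (fun x => cube_pos (x - c)).
  apply: measurable_funX; apply: measurable_maxr => //.
  by apply: measurable_funB.
rewrite (_ : smooth_step = (fun x => (cube_pos (x - 0) - 3 * cube_pos (x - 1)
  + 3 * cube_pos (x - 2) - cube_pos (x - 3)) / 6)); last first.
  by apply/funext => x; rewrite subr0.
apply: measurable_funM => //; apply: measurable_funB => //.
by apply: measurable_funD; [apply: measurable_funB => //|]; apply: measurable_funM.
Qed.

(* A second order expansion at 0 with constant [C], only required on [-1, 1]
   since [g] is bounded. *)
Definition jet2 (C : R) (g : R -> R) :=
  (forall t, 0 <= g t <= 1) /\ exists c0 c1 c2 : R,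
  [/\ `|c0| <= C, `|c1| <= C, `|c2| <= C &
    forall t, `|t| <= 1 -> `|g t - (c0 + c1 * t + c2 * t ^+ 2)| <= C * `|t| ^+ 3].

Lemma smooth_step_jet2 z k : `|k| <= 1 -> jet2 2 (fun t => smooth_step (z + k * t)).
Proof.
move=> k1; split; first by move=> t; exact: smooth_step_bounds.
(* Here [a] is the first derivative of the step at z and [b] half its second derivative, both
   written as third differences. The four Taylor remainders enter with weights 1, 3, 3, 1 over 6,
   for a total below 2. *)
pose m c := Num.max (z - c) 0.
pose a := (m 0 ^+ 2 - 3 * m 1 ^+ 2 + 3 * m 2 ^+ 2 - m 3 ^+ 2) / 2.
pose b := (m 0 - 3 * m 1 + 3 * m 2 - m 3) / 2.
have ab : `|a| <= 2 /\ `|b| <= 2.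
  rewrite !ler_norml /a /b /m subr0.
  have [x0|x0] := leP z 0; have [x1|x1] := leP (z - 1) 0;
  have [x2|x2] := leP (z - 2) 0; have [x3|x3] := leP (z - 3) 0; split;
    apply/andP; split; nra.
exists (smooth_step z), (a * k), (b * k ^+ 2); split.
- by have := smooth_step_bounds z; rewrite ler_norml; lra.
- by rewrite normrM; have := ab.1; have := normr_ge0 a; have := normr_ge0 k; nra.
- rewrite normrM normrX.
  have k2 : 0 <= `|k| ^+ 2 <= 1 by rewrite exprn_ge0//= exprn_ile1.
  by have := ab.2; have := normr_ge0 b; nra.
move=> t _; set h := k * t.
have hE : `|h| ^+ 3 <= `|t| ^+ 3.
  by rewrite lerXn2r ?nnegrE// normrM ler_piMl.
pose r c := cube_pos (z - c + h) - (cube_pos (z - c) + 3 * m c ^+ 2 * h + 3 * m c * h ^+ 2).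
have rh c : `|r c| <= `|h| ^+ 3 by exact: cube_pos_taylor.
rewrite (_ : _ - _ = (r 0 - 3 * r 1 + 3 * r 2 - r 3) / 6); last first.
  have e c : z + h - c = z - c + h by ring.
  rewrite /r !subr0 /smooth_step !e /a /b /h /m !subr0.
  by field.
have := rh 0; have := rh 1; have := rh 2; have := rh 3.
by rewrite !ler_norml; move: hE; lra.
Qed.

Lemma jet2_cst1 : jet2 1 (fun=> 1).
Proof.
split; first by move=> t; rewrite ler01 lexx.
exists 1, 0, 0; split; rewrite ?normr1 ?normr0//.
by move=> t _; rewrite !mul0r !addr0 subrr normr0 mul1r exprn_ge0.
Qed.

(** The remainder of the product splits into the remainder of g times h, the polynomial of g times
    the remainder of h, and the terms of degree three and four of the product of polynomials. They
    cost 1, 3 and 3 times C D, whence the 7. *)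
Lemma jet2_mul (C D : R) (g h : R -> R) : 1 <= C -> 1 <= D -> jet2 C g -> jet2 D h ->
  jet2 (7 * C * D) (fun t => g t * h t).
Proof.
move=> C1 D1 [g01 [c0 [c1 [c2 [c0C c1C c2C gE]]]]].
move=> [h01 [d0 [d1 [d2 [d0D d1D d2D hE]]]]]; split.
  move=> t; have /andP[g0 g1] := g01 t; have /andP[h0 h1] := h01 t.
  by rewrite mulr_ge0//= mulr_ile1.
have CD x y : `|x| <= C -> `|y| <= D -> `|x * y| <= C * D.
  by move=> xC yD; rewrite normrM ler_pM.
have CD0 : 0 <= C * D by rewrite mulr_ge0//; lra.
exists (c0 * d0), (c0 * d1 + c1 * d0), (c0 * d2 + c1 * d1 + c2 * d0); split.
- by rewrite (le_trans (CD _ _ c0C d0D))//; lra.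
- rewrite (le_trans (ler_normD _ _))//.
  by have := CD _ _ c0C d1D; have := CD _ _ c1C d0D; lra.
- rewrite (le_trans (ler_normD _ _))//.
  have := ler_normD (c0 * d2) (c1 * d1).
  by have := CD _ _ c0C d2D; have := CD _ _ c1C d1D; have := CD _ _ c2C d0D; lra.
move=> t t1; set P := c0 + c1 * t + c2 * t ^+ 2.
set Q := d0 + d1 * t + d2 * t ^+ 2.
set T := `|t| ^+ 3.
have T0 : 0 <= T by rewrite exprn_ge0.
rewrite (_ : _ - _ = (g t - P) * h t + P * (h t - Q)
  + (c1 * d2 + c2 * d1 + c2 * d2 * t) * t ^+ 3); last by rewrite /P /Q; ring.
have e1 : `|(g t - P) * h t| <= C * T.
  rewrite normrM -[leRHS]mulr1 ler_pM//; first exact: gE.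
  by have := h01 t; rewrite ler_norml; lra.
have PC : `|P| <= 3 * C.
  rewrite /P (le_trans (ler_normD _ _))//.
  have := ler_normD c0 (c1 * t).
  rewrite [`|c1 * _|]normrM [`|c2 * _|]normrM normrX.
  have t2 : 0 <= `|t| ^+ 2 <= 1 by rewrite exprn_ge0//= exprn_ile1.
  have a1 : `|c1| * `|t| <= C by rewrite -[leRHS]mulr1 ler_pM.
  have a2 : `|c2| * `|t| ^+ 2 <= C by case/andP: t2 => ? ?; rewrite -[leRHS]mulr1 ler_pM.
  by lra.
have e2 : `|P * (h t - Q)| <= 3 * C * (D * T).
  by rewrite normrM ler_pM//; exact: hE.
have e3 : `|(c1 * d2 + c2 * d1 + c2 * d2 * t) * t ^+ 3| <= 3 * (C * D) * T.
  rewrite normrM normrX ler_wpM2r// (le_trans (ler_normD _ _))//.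
  have := ler_normD (c1 * d2) (c2 * d1).
  have a3 : `|c2 * d2 * t| <= C * D.
    by rewrite normrM -[leRHS]mulr1 ler_pM//; exact: CD.
  by have := CD _ _ c1C d2D; have := CD _ _ c2C d1D; lra.
have CTD : C * T <= C * D * T.
  by rewrite ler_wpM2r// ler_peMr//; lra.
have := ler_normD ((g t - P) * h t + P * (h t - Q))
  ((c1 * d2 + c2 * d1 + c2 * d2 * t) * t ^+ 3).
have := ler_normD ((g t - P) * h t) (P * (h t - Q)).
lra.
Qed.

Lemma jet2_prod d (g : 'I_d -> R -> R) : (forall i, jet2 2 (g i)) ->
  jet2 (14 ^+ d) (fun t => \prod_(i < d) g i t).
Proof.
elim: d g => [|d IH] g jg.
  have := jet2_cst1; congr (jet2 _ _); apply/funext => t; by rewrite big_ord0.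
have j14 : jet2 (7 * 2 * 14 ^+ d) (fun t => g ord0 t * \prod_(i < d) g (lift ord0 i) t).
  apply: jet2_mul => //; [by lra| |by apply: IH].
  by rewrite exprn_ege1//; lra.
have e14 : 7 * 2 * 14 ^+ d = 14 ^+ d.+1 :> R by rewrite exprS; ring.
rewrite -e14; congr (jet2 _ _): j14.
by apply/funext => t; rewrite big_ord_recl.
Qed.

(** Outside [-1, 1] the function contributes at most 1 <= C t^2 and each of the three monomials at
    most C t^2, whence the factor 4. The resulting error is integrable under a second moment
    alone. *)
Lemma jet2_global (C : R) g : 1 <= C -> jet2 C g -> exists c0 c1 c2 : R,
  forall t, `|g t - (c0 + c1 * t + c2 * t ^+ 2)| <= 4 * C * (t ^+ 2 * Num.min 1 `|t|).
Proof.
move=> C1 [g01 [c0 [c1 [c2 [c0C c1C c2C gE]]]]]; exists c0, c1, c2 => t.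
rewrite -(real_normK (num_real t)).
have [t1|t1] := leP `|t| 1.
  have T0 := exprn_ge0 3 (normr_ge0 t).
  have CT : 0 <= C * `|t| ^+ 3 by rewrite mulr_ge0//; lra.
  by have := gE _ t1; rewrite -(real_normK (num_real t)); lra.
rewrite mulr1 (le_trans (ler_normB _ _))//.
have gt1 : `|g t| <= 1 by have := g01 t; rewrite ler_norml; lra.
have := ler_normD (c0 + c1 * t) (c2 * t ^+ 2).
have := ler_normD c0 (c1 * t).
rewrite -(real_normK (num_real t)).
rewrite [`|c1 * _|]normrM [`|c2 * _|]normrM normrX normr_id.
have := ler_wpM2r (normr_ge0 t) c1C.
have := ler_wpM2r (exprn_ge0 2 (normr_ge0 t)) c2C.
have tt : `|t| <= `|t| ^+ 2 by rewrite expr2 ler_peMr// ltW.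
have := ler_wpM2l (le_trans ler01 C1) tt.
have t2 : 1 <= `|t| ^+ 2 by rewrite (le_trans (ltW t1)).
have := ler_wpM2l (le_trans ler01 C1) t2.
lra.
Qed.

End smooth_step.

(** * Lindeberg replacement *)

Section second_moment.
Variables (R : realType) (mu : probability (measurableTypeR R) R).
Local Notation RR := (measurableTypeR R).
Hypothesis int2 : mu.-integrable setT (fun y : RR => (y ^+ 2)%:E).

(** A smooth variant of the Lindeberg truncated second moment, with [s] in the role of the size of
    one weight. *)
Definition sqr_tail (s : R) : R := \int[mu]_y (y ^+ 2 * Num.min 1 (s * `|y|)).

Lemma measurable_sqr_tail s : measurable_fun setT
  (fun y : RR => y ^+ 2 * Num.min 1 (s * `|y|)).
Proof.
apply: measurable_funM; first exact: measurable_funX.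
by apply: measurable_minr => //; apply: measurable_funM.
Qed.

Lemma sqr_tail_bounds s (y : R) : 0 <= s ->
  0 <= y ^+ 2 * Num.min 1 (s * `|y|) <= y ^+ 2.
Proof.
move=> s0; rewrite mulr_ge0 ?sqr_ge0//=; last first.
  by rewrite le_min ler01 mulr_ge0.
by rewrite ler_piMr ?sqr_ge0// ge_min lexx.
Qed.

Lemma sqr_tail_integrable s : 0 <= s ->
  mu.-integrable setT (fun y : RR => (y ^+ 2 * Num.min 1 (s * `|y|))%:E).
Proof.
move=> s0; apply: le_integrable int2 => //.
  by apply/measurable_EFinP; exact: measurable_sqr_tail.
move=> y _; have /andP[h0 h1] := sqr_tail_bounds y s0.
by rewrite /= lee_fin (ger0_norm h0) [leRHS]ger0_norm ?sqr_ge0.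
Qed.

Lemma sqr_tail_homo s t : 0 <= s -> s <= t -> sqr_tail s <= sqr_tail t.
Proof.
move=> s0 st; have t0 := le_trans s0 st.
apply: le_Rintegral => //; [exact: sqr_tail_integrable..|].
move=> y _; rewrite ler_wpM2l ?sqr_ge0// le_min !ge_min lexx/=.
by rewrite ler_wpM2r ?orbT.
Qed.

(** Dominated convergence along s = 1/(n+1), with dominating function y^2 and pointwise bound
    |y|^3/(n+1); monotonicity in [s] then covers all smaller values. *)
Lemma sqr_tail_small (e : R) : 0 < e -> exists2 s0, 0 < s0 &
  forall s, 0 <= s -> s <= s0 -> sqr_tail s <= e.
Proof.
move=> e0.
pose f_ n (y : RR) := (y ^+ 2 * Num.min 1 (n.+1%:R^-1 * `|y|))%:E.
have fcvg (y : RR) : f_ ^~ y @ \oo --> 0%E.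
  apply/fine_cvgP; split; first by apply: nearW.
  apply: (@squeeze_cvgr _ _ _ _ (cst 0) (fun n => n.+1%:R^-1 * (`|y| ^+ 3))).
  - apply: nearW => n /=.
    have ni : (0 : R) <= n.+1%:R^-1 by rewrite invr_ge0.
    have /andP[-> _] := sqr_tail_bounds y ni.
    have -> : n.+1%:R^-1 * `|y| ^+ 3 = y ^+ 2 * (n.+1%:R^-1 * `|y|).
      by rewrite -(real_normK (num_real y)); ring.
    by rewrite ler_wpM2l ?sqr_ge0// ge_min lexx orbT.
  - exact: cvg_cst.
  - rewrite -[X in _ --> X](mul0r (`|y| ^+ 3)); apply: cvgM; last exact: cvg_cst.
    exact: cvg_harmonic.
have mf_ n : measurable_fun setT (f_ n).
  by apply/measurable_EFinP; exact: measurable_sqr_tail.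
have f_le (y : RR) n : setT y -> (`|f_ n y| <= (y ^+ 2)%:E)%E.
  move=> _; have ni : (0 : R) <= n.+1%:R^-1 by rewrite invr_ge0.
  have /andP[h0 h1] := sqr_tail_bounds y ni.
  by rewrite /f_/= lee_fin ger0_norm.
have [_ _ /=] := dominated_convergence measurableT mf_ (measurable_cst 0%E)
  (aeW _ (fun y _ => fcvg y)) int2 (aeW _ f_le).
rewrite integral0 => /fine_cvgP[_ /cvgrPdist_le /(_ e e0)[N _ /(_ N (leqnn N))]].
rewrite sub0r normrN /= => tN.
exists N.+1%:R^-1; first by rewrite invr_gt0.
move=> s s0 sN; apply: (le_trans (sqr_tail_homo s0 sN)).
exact: le_trans (ler_norm _) tN.
Qed.

(** Integrating the expansion removes the linear term, the mean being 0, so that up to the error the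
    average depends on the law only through its variance [v]. *)
Lemma avg_expansion d (f : 'cV[R]_d -> R) w x (c0 c1 c2 K s v : R) :
  test_fun f -> 0 <= s ->
  (\int[mu]_y y%:E = 0)%E -> (\int[mu]_y (y ^+ 2)%:E = v%:E)%E ->
  (forall y, `|f (x + y *: w) - (c0 + c1 * y + c2 * y ^+ 2)| <=
    K * (y ^+ 2 * Num.min 1 (s * `|y|))) ->
  `|avg mu w f x - (c0 + c2 * v)| <= K * sqr_tail s.
Proof.
move=> tf s0 m1 m2 fE.
have int1 := sqr_integrable_id int2.
have intf : mu.-integrable setT (EFin \o (fun y : RR => f (x + y *: w))).
  apply/integrableP; split.
    by apply: test_fun_measurable => // i; exact: measurable_line.
  rewrite (eq_integral (fun y : RR => (f (x + y *: w))%:E)).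
    by rewrite -avgE// ltry.
  by move=> y _; rewrite gee0_abs// lee_fin; case/andP: (tf.1 (x + y *: w)).
have i0 : mu.-integrable setT (EFin \o (fun _ : RR => c0)).
  exact: finite_measure_integrable_cst.
have i1 : mu.-integrable setT (EFin \o (fun y : RR => c1 * y)).
  exact: (integrableZl measurableT c1 int1).
have i2 : mu.-integrable setT (EFin \o (fun y : RR => c2 * y ^+ 2)).
  exact: (integrableZl measurableT c2 int2).
have i01 : mu.-integrable setT (EFin \o (fun y : RR => c0 + c1 * y)).
  exact: (integrableD measurableT i0 i1).
have ip : mu.-integrable setT (EFin \o (fun y : RR => c0 + c1 * y + c2 * y ^+ 2)).
  exact: (integrableD measurableT i01 i2).
have polyE : c0 + c2 * v = \int[mu]_y (c0 + c1 * y + c2 * y ^+ 2).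
  rewrite RintegralD// RintegralD// !RintegralZl// Rintegral_cst//.
  rewrite /Rintegral m1 m2/= mulr0 addr0.
  by rewrite [X in fine X](@probability_setT _ _ _ mu) mulr1.
have -> : avg mu w f x = \int[mu]_y f (x + y *: w) by [].
rewrite polyE -RintegralB//.
have id : mu.-integrable setT (EFin \o
    (fun y : RR => f (x + y *: w) - (c0 + c1 * y + c2 * y ^+ 2))).
  exact: (integrableB measurableT intf ip).
rewrite (le_trans (le_normr_Rintegral _ id))//.
rewrite /sqr_tail -RintegralZl//; last exact: sqr_tail_integrable.
apply: le_Rintegral => //; first exact: (integrable_norm id).
exact: (integrableZl measurableT K (sqr_tail_integrable s0)).
Qed.

End second_moment.

Section box_test.
Variables (R : realType) (d : nat) (a : 'cV[R]_d) (e : R).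
Hypothesis e0 : 0 < e.

(** The offset 3 puts the whole transition outside the orthant: the product is 1 on the orthant at
    [a] and 0 once some coordinate exceeds that of [a] by 3e. *)
Definition smooth_box (x : 'cV[R]_d) : R :=
  \prod_(i < d) smooth_step ((a i 0 - x i 0) / e + 3).

Lemma smooth_box_test_fun : test_fun smooth_box.
Proof.
split=> [x|disp T g mg].
  rewrite prodr_ge0/=; last first.
    by move=> i _; case/andP: (smooth_step_bounds ((a i 0 - x i 0) / e + 3)).
  by apply: prodr_ile1 => i _; exact: smooth_step_bounds.
apply: measurable_prod => i _; apply: measurableT_comp.
  exact: measurable_smooth_step.
by apply: measurable_funD => //; apply: measurable_funM => //; apply: measurable_funB.
Qed.

Lemma smooth_box_in (x : 'cV[R]_d) : (forall i, x i 0 <= a i 0) -> smooth_box x = 1.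
Proof.
move=> xa; rewrite /smooth_box big1// => i _; apply: smooth_step_ge3.
by rewrite lerDr divr_ge0 ?(ltW e0)// subr_ge0.
Qed.

Lemma smooth_box_out (x : 'cV[R]_d) i : a i 0 + 3 * e < x i 0 -> smooth_box x = 0.
Proof.
move=> xa; rewrite /smooth_box (bigD1 i)//= smooth_step_le0 ?mul0r//.
have -> : (a i 0 - x i 0) / e + 3 = (a i 0 + 3 * e - x i 0) / e.
  by field; rewrite gt_eqF.
by rewrite pmulr_lle0 ?invr_gt0//; move: xa; rewrite -subr_lt0 => /ltW.
Qed.

Lemma smooth_box_expansion x w : exists c0 c1 c2 : R, forall y,
  `|smooth_box (x + y *: w) - (c0 + c1 * y + c2 * y ^+ 2)| <=
    4 * 14 ^+ d / e ^+ 2 * enorm w ^+ 2 * (y ^+ 2 * Num.min 1 (enorm w / e * `|y|)).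
Proof.
have [w0|w0] := eqVneq (enorm w) 0.
  exists (smooth_box x), 0, 0 => y.
  rewrite [in leLHS](enorm_eq0 w0) scaler0 addr0 !mul0r !addr0 subrr normr0.
  by rewrite w0 expr0n/= mulr0 mul0r.
have n0 : 0 < enorm w by rewrite lt_neqAle eq_sym w0 enorm_ge0.
(* In the variable t = s y each factor is a step of slope at most 1 in absolute value, because |w_i|
   <= |w|. The jet constant is thus uniform in [w], and undoing the scaling produces the factor
   |w|^2/e^2. *)
pose s := enorm w / e; have s0 : 0 < s by rewrite divr_gt0.
have jet : jet2 (14 ^+ d) (fun t => smooth_box (x + (t / s) *: w)).
  have -> : (fun t => smooth_box (x + (t / s) *: w)) = (fun t =>
      \prod_(i < d) smooth_step (((a i 0 - x i 0) / e + 3) + (- (w i 0 / enorm w)) * t)).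
    apply/funext => t; apply: eq_bigr => i _; congr smooth_step; rewrite !mxE /s.
    by field; rewrite w0 gt_eqF.
  apply: (@jet2_prod _ _ (fun i t => smooth_step
    (((a i 0 - x i 0) / e + 3) + (- (w i 0 / enorm w)) * t))) => i.
  apply: smooth_step_jet2.
  rewrite normrN normrM normfV (ger0_norm (enorm_ge0 w)) ler_pdivrMr// mul1r.
  exact: normr_le_enorm.
have [|c0 [c1 [c2 cE]]] := jet2_global _ jet.
  by rewrite exprn_ege1//; lra.
exists c0, (c1 * s), (c2 * s ^+ 2) => y.
have := cE (s * y).
rewrite (mulrC s y) mulfK ?gt_eqF// normrM (gtr0_norm s0) (mulrC `|y|).
have -> : c1 * (y * s) = c1 * s * y by ring.
have -> : c2 * (y * s) ^+ 2 = c2 * s ^+ 2 * y ^+ 2 by ring.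
move=> /le_trans; apply; rewrite -/s exprMn /s expr_div_n.
by rewrite le_eqVlt; apply/orP; left; apply/eqP; ring.
Qed.

(** Both averages use the same expansion along [w], hence the same [c0] and [c2]. Scaling the
    Gaussian direction by [sigma] matches the variances, so both are close to c0 + c2 sigma^2. *)
Lemma smooth_box_swap (nu : probability (measurableTypeR R) R) (sigma : R) x w :
  0 < sigma ->
  nu.-integrable setT (fun y : measurableTypeR R => (y ^+ 2)%:E) ->
  (\int[nu]_y y%:E = 0)%E -> (\int[nu]_y (y ^+ 2)%:E = (sigma ^+ 2)%:E)%E ->
  `|avg nu w smooth_box x - avg (normal_prob 0 1) (sigma *: w) smooth_box x| <=
  4 * 14 ^+ d / e ^+ 2 * enorm w ^+ 2 *
   (sqr_tail nu (enorm w / e) +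
    sigma ^+ 2 * sqr_tail (normal_prob 0 1) (sigma * (enorm w / e))).
Proof.
move=> s0 int2 m1 m2; have [c0 [c1 [c2 cE]]] := smooth_box_expansion x w.
set K := 4 * _ / _ in cE *.
have we : 0 <= enorm w / e by rewrite divr_ge0 ?enorm_ge0 ?ltW.
have b1 := avg_expansion int2 smooth_box_test_fun we m1 m2 cE.
have cE2 y : `|smooth_box (x + y *: (sigma *: w)) -
    (c0 + c1 * sigma * y + c2 * sigma ^+ 2 * y ^+ 2)| <=
    K * enorm w ^+ 2 * sigma ^+ 2 * (y ^+ 2 * Num.min 1 (sigma * (enorm w / e) * `|y|)).
  have := cE (y * sigma); rewrite scalerA normrM (gtr0_norm s0).
  have -> : c1 * (y * sigma) = c1 * sigma * y by ring.
  have -> : c2 * (y * sigma) ^+ 2 = c2 * sigma ^+ 2 * y ^+ 2 by ring.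
  have -> : enorm w / e * (`|y| * sigma) = sigma * (enorm w / e) * `|y| by ring.
  move=> /le_trans; apply; rewrite le_eqVlt; apply/orP; left; apply/eqP.
  by ring.
have swe : 0 <= sigma * (enorm w / e) by rewrite mulr_ge0// ltW.
have := avg_expansion (@gauss_sqr_integrable R) smooth_box_test_fun swe
  (@gauss_mean R) (@gauss_second_moment R) cE2.
rewrite mulr1 => b2.
rewrite (le_trans (ler_distD (c0 + c2 * sigma ^+ 2) _ _))// mulrDr lerD//.
by rewrite distrC [leRHS]mulrA.
Qed.

End box_test.

Lemma lindeberg_box (R : realType) d (a : 'cV[R]_d) (e sigma B : R)
    (nu : probability (measurableTypeR R) R) : 0 < e -> 0 < sigma -> 0 < B ->
  nu.-integrable setT (fun y : measurableTypeR R => (y ^+ 2)%:E) ->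
  (\int[nu]_y y%:E = 0)%E -> (\int[nu]_y (y ^+ 2)%:E = (sigma ^+ 2)%:E)%E ->
  forall eta : R, 0 < eta -> exists2 r : R, 0 < r &
  forall ws : seq 'cV[R]_d, (forall w, w \in ws -> enorm w <= r) ->
    \sum_(w <- ws) enorm w ^+ 2 <= B ->
  `|avgs nu ws (smooth_box a e) 0 -
    avgs (normal_prob 0 1) [seq sigma *: w | w <- ws] (smooth_box a e) 0| <= eta.
Proof.
move=> e0 s0 B0 int2 m1 m2 eta eta0.
have [K KE K0] : exists2 K : R, K = 4 * 14 ^+ d / e ^+ 2 & 0 < K.
  by eexists; first reflexivity; rewrite divr_gt0 ?mulr_gt0 ?exprn_gt0.
(* With this tolerance for both tails, the costs K t (1 + sigma^2) |w|^2 add up to at most [eta],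
   because the squared norms sum to at most [B]. *)
pose t := eta / (K * B * (1 + sigma ^+ 2)).
have ss : 0 < 1 + sigma ^+ 2 by rewrite ltr_wpDr ?sqr_ge0.
have t0 : 0 < t by rewrite divr_gt0// !mulr_gt0.
have [r1 r10 tail1] := sqr_tail_small int2 t0.
have [r2 r20 tail2] := sqr_tail_small (@gauss_sqr_integrable R) t0.
exists (e * Num.min r1 (r2 / sigma)); first by rewrite mulr_gt0// lt_min r10 divr_gt0.
move=> ws wsr wsB.
apply: le_trans (lindeberg_swap (nu := normal_prob 0 1) (F := fun w => sigma *: w)
  (D := fun w => K * t * (1 + sigma ^+ 2) * enorm w ^+ 2) (smooth_box_test_fun a e) _ 0) _.
  move=> w wws x; apply: le_trans (smooth_box_swap a e0 x w s0 int2 m1 m2) _.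
  have := wsr w wws; rewrite -ler_pdivrMl// mulrC le_min => /andP[w1 w2].
  have w0 : 0 <= enorm w / e by rewrite divr_ge0 ?enorm_ge0 ?ltW.
  have b1 := tail1 _ w0 w1.
  have b2 : sqr_tail (normal_prob 0 1) (sigma * (enorm w / e)) <= t.
    apply: tail2; first by rewrite mulr_ge0// ltW.
    by rewrite mulrC -ler_pdivlMr.
  rewrite -KE -[leRHS](_ : K * enorm w ^+ 2 * (t + sigma ^+ 2 * t) = _); last by ring.
  apply: ler_wpM2l; first by rewrite mulr_ge0 ?sqr_ge0// ltW.
  by rewrite lerD// ler_wpM2l// sqr_ge0.
rewrite -mulr_sumr; apply: le_trans (ler_wpM2l _ wsB) _.
  exact: ltW (mulr_gt0 (mulr_gt0 K0 t0) ss).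
rewrite /t le_eqVlt; apply/orP; left; apply/eqP; field.
by rewrite !gt_eqF.
Qed.

(** * Second moments of linear forms *)

Lemma ge0_integral_law (R : realType) disp (T : measurableType disp)
    (P : probability T R) (X : {RV P >-> R}) (nu : probability (measurableTypeR R) R)
    (g : measurableTypeR R -> \bar R) :
  (forall B : set R, measurable B -> distribution P X B = nu B) ->
  measurable_fun setT g -> (forall y, 0 <= g y)%E ->
  (\int[P]_w g (X w) = \int[nu]_y g y)%E.
Proof.
move=> XE mg g0; pose f : T -> measurableTypeR R := X.
have mf : measurable_fun setT f by exact: (@measurable_funP _ _ _ _ _ X).
pose F : {mfun T >-> measurableTypeR R} :=
  HB.pack f (isMeasurableFun.Build _ _ _ _ f mf).
transitivity (\int[distribution P F]_y g y)%E.
  by rewrite ge0_integral_distribution.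
by apply: eq_measure_integral => B mB _; exact: (XE B mB).
Qed.

Lemma law_second_moment (R : realType) disp (T : measurableType disp)
    (P : probability T R) (X : {RV P >-> R}) (nu : probability (measurableTypeR R) R)
    (v : R) :
  (forall B : set R, measurable B -> distribution P X B = nu B) ->
  ('E_P[X] = 0)%E -> ('V_P[X] = v%:E)%E ->
  (\int[nu]_y (y ^+ 2)%:E = v%:E)%E.
Proof.
move=> XE EX VX; rewrite -VX -(ge0_integral_law XE); last 2 first.
- by apply/measurable_EFinP; exact: measurable_funX.
- by move=> y; rewrite lee_fin sqr_ge0.
rewrite /variance covariance.unlock EX expectation.unlock /=.
apply: eq_integral => w _; congr (_%:E).
by transitivity ((X w - 0) * (X w - 0)); first by rewrite subr0 expr2.
Qed.

Lemma sqr_integrable_law (R : realType) (nu : probability (measurableTypeR R) R) v :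
  (\int[nu]_y (y ^+ 2)%:E = v%:E)%E ->
  nu.-integrable setT (fun y : measurableTypeR R => (y ^+ 2)%:E).
Proof.
move=> nu2; apply/integrableP; split.
  by apply/measurable_EFinP; exact: measurable_funX.
rewrite (eq_integral (fun y : measurableTypeR R => (y ^+ 2)%:E)).
  by rewrite nu2 ltry.
by move=> y _; rewrite gee0_abs// lee_fin sqr_ge0.
Qed.

Lemma law_mean (R : realType) disp (T : measurableType disp)
    (P : probability T R) (X : {RV P >-> R}) (nu : probability (measurableTypeR R) R) :
  (forall B : set R, measurable B -> distribution P X B = nu B) ->
  ('E_P[X] = 0)%E -> (\int[nu]_y y%:E = 0)%E.
Proof.
move=> XE EX.
have intE (h : measurableTypeR R -> \bar R) : measurable_fun setT h ->
    (forall y, 0 <= h y)%E -> (\int[P]_w h (X w) = \int[nu]_y h y)%E.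
  exact: ge0_integral_law.
rewrite -EX unlock integralE [RHS]integralE.
have mE : measurable_fun setT (EFin : measurableTypeR R -> \bar R).
  by apply/measurable_EFinP.
congr (_ - _)%E.
  rewrite -(intE ((EFin : measurableTypeR R -> \bar R)^\+)%E) //.
  - by apply: eq_integral => w _; rewrite !funeposE.
  - exact: measurable_funepos.
rewrite -(intE ((EFin : measurableTypeR R -> \bar R)^\-)%E) //.
- by apply: eq_integral => w _; rewrite !funenegE.
- exact: measurable_funeneg.
Qed.

Section linear_forms.
Variables (R : realType) (nu : probability (measurableTypeR R) R) (v : R).
Hypotheses (nu1 : (\int[nu]_y y%:E = 0)%E) (nu2 : (\int[nu]_y (y ^+ 2)%:E = v%:E)%E).

(** The summand [b] carries the variance of the coordinates already integrated in the induction of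
    [integral_sqr_linear]. *)
Lemma integral_sqr_affine (c a b : R) :
  (\int[nu]_y ((c + a * y) ^+ 2 + b)%:E = (c ^+ 2 + a ^+ 2 * v + b)%:E)%E.
Proof.
have int2 := sqr_integrable_law nu2.
have int1 := sqr_integrable_id int2.
have i0 : nu.-integrable setT (fun _ : measurableTypeR R => (c ^+ 2 + b)%:E).
  exact: finite_measure_integrable_cst.
have i1 := integrableZl measurableT (2 * c * a) int1.
have i2 := integrableZl measurableT (a ^+ 2) int2.
transitivity (\int[nu]_y ((c ^+ 2 + b)%:E + (2 * c * a)%:E * y%:E
  + (a ^+ 2)%:E * (y ^+ 2)%:E))%E.
  apply: eq_integral => y _; rewrite -!EFinM -!EFinD; congr (_%:E); ring.
rewrite integralD//=; last exact: integrableD.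
rewrite integralD//= !integralZl// nu1 nu2 mule0 adde0.
rewrite integral_cst//= [X in (_ * X)%E](@probability_setT _ _ _ nu) mule1.
by rewrite -EFinM -EFinD; congr (_%:E); ring.
Qed.

Lemma integral_sqr_linear n (a : 'I_n -> R) (c : R) :
  (\int[iid_power nu n]_t ((c + \sum_(i < n) a i * tnth t i) ^+ 2)%:E =
   (c ^+ 2 + v * \sum_(i < n) a i ^+ 2)%:E)%E.
Proof.
have mS m (b : 'I_m -> R) k : measurable_fun setT
    (fun t : m.-tuple (measurableTypeR R) => ((k + \sum_(i < m) b i * tnth t i) ^+ 2)%:E).
  apply/measurable_EFinP; apply: measurable_funX; apply: measurable_funD => //.
  apply: measurable_sum => i; apply: measurable_funM => //; exact: measurable_tnth.
elim: n a c => [|n IH] a c.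
  rewrite integral_dirac// ?diracE ?in_setT ?mul1e; last exact: mS.
  by rewrite !big_ord0 mulr0 !addr0.
rewrite ge0_integral_iid_power; last 2 first.
- exact: mS.
- by move=> t; rewrite lee_fin sqr_ge0.
transitivity (\int[nu]_y ((c + a ord0 * y) ^+ 2
    + v * \sum_(i < n) a (lift ord0 i) ^+ 2)%:E)%E.
  apply: eq_integral => y _; rewrite -IH; apply: eq_integral => t _.
  congr ((_ ^+ 2)%:E); rewrite big_ord_recl /= addrA; congr (_ + _).
  by apply: eq_bigr => i _; rewrite !tnthS.
rewrite integral_sqr_affine; congr (_%:E); rewrite big_ord_recl; ring.
Qed.

Lemma expectation_sqr_norm disp (T : measurableType disp) (P : probability T R)
    n m (X : 'I_n -> {RV P >-> R}) (M : 'M[R]_(m, n)) : iid_with_law X nu ->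
  (\int[P]_w (enorm (M *m \col_i X i w) ^+ 2)%:E = (v * \tr (M *m M^T))%:E)%E.
Proof.
move=> Xiid.
pose h k (t : n.-tuple (measurableTypeR R)) := ((0 + \sum_(i < n) M k i * tnth t i) ^+ 2)%:E.
have mh k : measurable_fun setT (h k).
  apply/measurable_EFinP; apply: measurable_funX; apply: measurable_funD => //.
  apply: measurable_sum => i; apply: measurable_funM => //; exact: measurable_tnth.
have h0 k t : (0 <= h k t)%E by rewrite lee_fin sqr_ge0.
transitivity (\int[P]_w \sum_(k < m) h k [tuple X i w | i < n])%E.
  apply: eq_integral => w _; rewrite sumEFin; congr (_%:E).
  rewrite enorm_sqr dotE; apply: eq_bigr => k _; rewrite -expr2; congr (_ ^+ 2).
  by rewrite add0r mxE; apply: eq_bigr => i _; rewrite tnth_mktuple mxE.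
have mX : measurable_fun setT (fun w => [tuple X i w | i < n] : n.-tuple (measurableTypeR R)).
  apply/measurable_fun_tnthP => i.
  rewrite (_ : _ \o _ = X i); first exact: (@measurable_funP _ _ _ _ _ (X i)).
  by apply/funext => w /=; rewrite tnth_mktuple.
rewrite ge0_integral_sum//; last by move=> k; exact: (measurableT_comp (mh k) mX).
rewrite /mxtrace mulr_sumr -sumEFin; apply: eq_bigr => k _.
rewrite (iid_law_tuple Xiid (mh k) (h0 k)) integral_sqr_linear expr0n/= add0r.
congr ((_ * _)%:E); rewrite mxE; apply: eq_bigr => i _.
by rewrite mxE expr2.
Qed.

End linear_forms.

Lemma markov_sqr_norm (R : realType) (nu : probability (measurableTypeR R) R) (v c : R)
    disp (T : measurableType disp) (P : probability T R)
    n m (X : 'I_n -> {RV P >-> R}) (M : 'M[R]_(m, n)) : iid_with_law X nu ->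
  (\int[nu]_y y%:E = 0)%E -> (\int[nu]_y (y ^+ 2)%:E = v%:E)%E -> 0 < c ->
  measurable [set w | c < enorm (M *m \col_i X i w) ^+ 2] /\
  (P [set w | (c < enorm (M *m \col_i X i w) ^+ 2)%R] <= (v * \tr (M *m M^T) / c)%:E)%E.
Proof.
move=> Xiid nu1 nu2 c0.
pose V w := enorm (M *m \col_i X i w) ^+ 2.
have mV : measurable_fun setT V.
  rewrite (_ : V = fun w => \sum_(k < m) (\sum_(i < n) M k i * X i w) ^+ 2); last first.
    apply/funext => w; rewrite /V enorm_sqr dotE; apply: eq_bigr => k _.
    by rewrite -expr2 mxE; congr (_ ^+ 2); apply: eq_bigr => i _; rewrite mxE.
  apply: measurable_sum => k; apply: measurable_funX; apply: measurable_sum => i.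
  by apply: measurable_funM.
have mA : measurable [set w | c < V w].
  rewrite -[X in measurable X]setTI; have := mV measurableT `]c, +oo[%classic.
  rewrite (_ : V @^-1` _ = [set w | c < V w]); first by apply.
  by apply/seteqP; split => w /=; rewrite in_itv/= andbT.
split => //.
rewrite EFinM -(expectation_sqr_norm nu1 nu2 M Xiid) lee_pdivlMr// muleC.
rewrite -(integral_cst P mA) -/V.
apply: le_trans (_ : (\int[P]_(w in [set w | (c < V w)%R]) (V w)%:E <= _)%E).
  apply: ge0_le_integral => //.
  - by move=> w _; rewrite lee_fin ltW.
  - exact/measurable_EFinP/measurable_funTS.
  - by move=> w /ltW; rewrite lee_fin.
apply: ge0_subset_integral => //; first exact/measurable_EFinP.
by move=> w _; rewrite lee_fin sqr_ge0.
Qed.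

(** * Central limit theorem for linear forms *)

Lemma measurable_orthant (R : realType) d disp (T : measurableType disp)
    (Z : T -> 'cV[R]_d) (x : 'cV[R]_d) :
  (forall i, measurable_fun setT (fun w => Z w i 0)) ->
  measurable [set w | forall i, Z w i 0 <= x i 0].
Proof.
move=> mZ; rewrite (_ : mkset _ =
  \bigcap_(i in [set: 'I_d]) [set w | Z w i 0 <= x i 0]); last first.
  by apply/seteqP; split=> [t h i _|t h i]; [exact: h|exact: (h i I)].
apply: fin_bigcap_measurable => [|i _]; first exact: finite_finset.
rewrite -[X in measurable X]setTI.
have := mZ i measurableT `]-oo, x i 0]%classic.
by rewrite set_itvNyc; apply; rewrite -set_itvNyc; exact: measurable_itv.
Qed.

Lemma measurable_linear_form (R : realType) d n disp (T : measurableType disp)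
    (P : probability T R) (X : 'I_n -> {RV P >-> R}) (W : 'M[R]_(d, n)) i :
  measurable_fun setT (fun w => (W *m \col_j X j w) i 0).
Proof.
rewrite (_ : (fun _ => _) = (fun w => \sum_(j < n) W i j * X j w)); last first.
  by apply/funext => w; rewrite mxE; apply: eq_bigr => j _; rewrite mxE.
by apply: measurable_sum => j; apply: measurable_funM.
Qed.

Section clt.
Variables (R : realType) (d : nat) (nu : probability (measurableTypeR R) R).
Variable sigma : R.
Hypothesis nu1 : (\int[nu]_y y%:E = 0)%E.
Hypothesis nu2 : (\int[nu]_y (y ^+ 2)%:E = (sigma ^+ 2)%:E)%E.
Hypothesis s0 : 0 < sigma.
Let cdf (x : 'cV[R]_d) : R := fine (joint_cdf (std_normal R d) x).

Lemma measurable_tuple_le (x : 'cV[R]_d) :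
  measurable [set t : d.-tuple (measurableTypeR R) | forall i, tnth t i <= x i 0].
Proof.
apply: (@measurable_tuple_box R d (fun i => [set y | y <= x i 0])) => i.
by rewrite -set_itvNyc; exact: measurable_itv.
Qed.

Lemma joint_cdfE (x : 'cV[R]_d) : joint_cdf (std_normal R d) x = (cdf x)%:E.
Proof.
rewrite /cdf fineK// /joint_cdf.
exact: (@fin_num_measure _ _ _ (std_normal R d) _ (measurable_tuple_le x)).
Qed.

Lemma test_fun_integral_le disp (T : measurableType disp) (Q : probability T R)
    (f : 'cV[R]_d -> R) (Z : T -> 'cV[R]_d) (A : set T) :
  test_fun f -> (forall i, measurable_fun setT (fun t => Z t i 0)) ->
  measurable A -> (forall t, ~ A t -> f (Z t) = 0) ->
  (\int[Q]_t (f (Z t))%:E <= Q A)%E.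
Proof.
move=> tf mZ mA fA; rewrite -(setIT A) -integral_indic//.
apply: ge0_le_integral => //.
- by move=> t _; rewrite lee_fin; case/andP: (tf.1 (Z t)).
- exact: test_fun_measurable.
- by apply/measurable_EFinP; exact: measurable_indic.
- move=> t _; rewrite lee_fin indicE; have [At|At] := pselect (A t).
    by rewrite mem_set//; case/andP: (tf.1 (Z t)).
  by rewrite fA// memNset.
Qed.

Lemma test_fun_integral_ge disp (T : measurableType disp) (Q : probability T R)
    (f : 'cV[R]_d -> R) (Z : T -> 'cV[R]_d) (A : set T) :
  test_fun f -> (forall i, measurable_fun setT (fun t => Z t i 0)) ->
  measurable A -> (forall t, A t -> f (Z t) = 1) ->
  (Q A <= \int[Q]_t (f (Z t))%:E)%E.
Proof.
move=> tf mZ mA fA; rewrite -(setIT A) -integral_indic//.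
apply: ge0_le_integral => //.
- by apply/measurable_EFinP; exact: measurable_indic.
- exact: test_fun_measurable.
- move=> t _; rewrite lee_fin indicE; have [At|At] := pselect (A t).
    by rewrite mem_set// fA.
  by rewrite memNset//; case/andP: (tf.1 (Z t)).
Qed.

Definition shift_cV (x : 'cV[R]_d) (e : R) : 'cV[R]_d := x + const_mx e.

Lemma gauss_box_bounds (x : 'cV[R]_d) e : 0 < e ->
  ((joint_cdf (std_normal R d) x <=
    \int[std_normal R d]_t (smooth_box x e (\col_i tnth t i))%:E) /\
  (\int[std_normal R d]_t (smooth_box x e (\col_i tnth t i))%:E <=
    joint_cdf (std_normal R d) (shift_cV x (3 * e))))%E.
Proof.
move=> e0; have tf := smooth_box_test_fun x e.
have mc i : measurable_fun setT
    (fun t : d.-tuple (measurableTypeR R) => (\col_i tnth t i) i 0 : R).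
  under eq_fun do rewrite mxE.
  exact: measurable_tnth.
split.
  apply: (test_fun_integral_ge (std_normal R d) tf mc).
    exact: measurable_tuple_le.
  by move=> t tx; apply: smooth_box_in => // i; rewrite mxE.
apply: (test_fun_integral_le (std_normal R d) tf mc).
  exact: measurable_tuple_le.
move=> t /existsNP[i /negP]; rewrite -ltNge !mxE => xt.
by apply: (smooth_box_out e0 (i := i)); rewrite mxE.
Qed.

Lemma clt_box (x : 'cV[R]_d) (e eta : R) : 0 < e -> 0 < eta ->
  exists2 r : R, 0 < r &
  forall disp (T : measurableType disp) (P : probability T R) n
    (X : 'I_n -> {RV P >-> R}) (W : 'M[R]_(d, n)),
  iid_with_law X nu -> W *m W^T = (sigma ^- 2)%:M ->
  (forall i, enorm (col i W) <= r) ->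
  let S := fun w => W *m \col_i X i w in
  (joint_cdf (std_normal R d) x - eta%:E <=
    \int[P]_w (smooth_box x e (S w))%:E)%E /\
  (\int[P]_w (smooth_box x e (S w))%:E <=
    joint_cdf (std_normal R d) (shift_cV x (3 * e)) + eta%:E)%E.
Proof.
(* The squared norms of the columns of W sum to the trace of W W', that is d sigma^-2; the added 1
   keeps [B] positive even for d = 0. *)
move=> e0 eta0; pose B : R := d%:R * sigma ^- 2 + 1.
have B0 : 0 < B by rewrite ltr_wpDl// mulr_ge0// invr_ge0 sqr_ge0.
have int2 := sqr_integrable_law nu2.
have [r r0 lin] := lindeberg_box x e0 s0 B0 int2 nu1 nu2 eta0.
exists r => // disp T P n X W Xiid WW Wr S.
have tf := smooth_box_test_fun x e.
pose ws : n.-tuple 'cV[R]_d := [tuple col i W | i < n].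
have Swr : (\int[P]_w (smooth_box x e (S w))%:E = (avgs nu ws (smooth_box x e) 0)%:E)%E.
  rewrite -integral_avgs//.
  set g := fun t : n.-tuple _ => (smooth_box x e (0 + \sum_(i < n) tnth t i *: tnth ws i))%:E.
  rewrite -[RHS]/(\int[iid_power nu n]_t g t)%E -(iid_law_tuple Xiid (g := g)).
  - apply: eq_integral => w _; rewrite /g /S add0r; congr ((smooth_box x e _)%:E).
    apply/colP => k; rewrite mxE summxE; apply: eq_bigr => i _.
    by rewrite !tnth_mktuple !mxE mulrC.
  - apply: test_fun_measurable => // j.
    rewrite (_ : (fun _ => _) = (fun t : n.-tuple (measurableTypeR R) =>
        \sum_(i < n) tnth t i * tnth ws i j 0)); last first.
      by apply/funext => t; rewrite add0r summxE; apply: eq_bigr => i _; rewrite mxE.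
    apply: measurable_sum => i.
    by apply: measurable_funM => //; exact: measurable_tnth.
  - by move=> t; rewrite lee_fin; case/andP: (tf.1 (0 + \sum_(i < n) tnth t i *: tnth ws i)).
have wsr w : w \in (ws : seq _) -> enorm w <= r.
  by move=> /mapP[i _ ->]; exact: Wr.
have trE : \tr (W *m W^T) = d%:R * sigma ^- 2.
  by rewrite WW mxtrace_scalar mulr_natl.
have wsB : \sum_(w <- ws) enorm w ^+ 2 <= B.
  rewrite big_map big_enum/= /B -trE mxtrace_mulC -[leLHS]addr0 lerD// /mxtrace.
  rewrite le_eqVlt; apply/orP; left; apply/eqP; apply: eq_bigr => i _.
  by rewrite enorm_sqr dotE mxE; apply: eq_bigr => k _; rewrite !mxE.
have := lin ws wsr wsB.
have sum1 : outer_sum [seq sigma *: w | w <- ws] = 1%:M.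
  have -> : 1%:M = sigma ^+ 2 *: (W *m W^T).
    by rewrite WW scale_scalar_mx mulfV// sqrf_eq0 gt_eqF.
  apply/matrixP => k l; rewrite outer_sumE big_map big_map big_enum/= !mxE.
  rewrite mulr_sumr; apply: eq_bigr => i _; rewrite !mxE; ring.
have [gl gu] := gauss_box_bounds x e0.
move: gl gu; rewrite -(gaussian_avgs tf sum1) Swr !joint_cdfE.
rewrite -EFinB -EFinD !lee_fin ler_norml => gl gu /andP[h1 h2].
by split; lra.
Qed.

(** The radius [r] is chosen before the probability space, the sample size and the weights, so the
    bound can be used along a triangular array. *)
Lemma weighted_clt (x : 'cV[R]_d) (eta : R) : 0 < eta ->
  {for x, continuous (joint_cdf (std_normal R d))} ->
  exists2 r : R, 0 < r &
  forall disp (T : measurableType disp) (P : probability T R) n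
    (X : 'I_n -> {RV P >-> R}) (W : 'M[R]_(d, n)),
  iid_with_law X nu -> W *m W^T = (sigma ^- 2)%:M ->
  (forall i, enorm (col i W) <= r) ->
  let S := fun w => W *m \col_i X i w in
  (joint_cdf (std_normal R d) x - eta%:E <=
    P [set w | forall i, (S w i 0 <= x i 0)%R])%E /\
  (P [set w | forall i, (S w i 0 <= x i 0)%R] <=
    joint_cdf (std_normal R d) x + eta%:E)%E.
Proof.
move=> eta0 ctsx.
have : joint_cdf (std_normal R d) y @[y --> x] --> (cdf x)%:E.
  by rewrite -joint_cdfE; exact: ctsx.
move=> /fine_cvgP[_ /cvgrPdist_le /(_ (eta / 2))].
have eta20 : 0 < eta / 2 by rewrite divr_gt0.
move=> /(_ eta20)/nbhs_ballP[u /= u0 ball_u].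
(* The transition zone has width 3e = u/2, which stays inside the ball where the limit distribution
   function varies by at most eta/2. *)
pose e := u / 6; have e0 : 0 < e by rewrite divr_gt0.
have near_x c : `|c| < u -> `|cdf x - cdf (shift_cV x c)| <= eta / 2.
  move=> cu; apply: ball_u; split=> [//|i j]; rewrite !mxE /ball/=.
  by rewrite opprD addNKr normrN.
(* The box at [x] dominates the indicator of the orthant and gives the upper bound; the box at [x']
   vanishes off that orthant and gives the lower bound. *)
pose x' := shift_cV x (- (3 * e)).
have x'x : shift_cV x' (3 * e) = x.
  by apply/colP => i; rewrite !mxE subrK.
have [r1 r10 clt1] := clt_box x e0 eta20.
have [r2 r20 clt2] := clt_box x' e0 eta20.
exists (Num.min r1 r2); first by rewrite lt_min r10.
move=> disp T P n X W Xiid WW Wr; pose S w := W *m \col_i X i w.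
have mS := measurable_linear_form X W.
have mA := measurable_orthant x mS.
have ce : `|3 * e| < u by rewrite gtr0_norm /e; lra.
split.
  apply: le_trans (_ : (\int[P]_w (smooth_box x' e (S w))%:E <= _)%E); last first.
    apply: test_fun_integral_le => //; first exact: smooth_box_test_fun.
    move=> w /existsNP[i /negP]; rewrite -ltNge => xS.
    have x'i : x' i 0 + 3 * e = x i 0 by rewrite !mxE subrK.
    by apply: (smooth_box_out e0 (i := i)); rewrite x'i.
  have [|+ _] := clt2 _ _ _ _ _ _ Xiid WW.
    by move=> i; rewrite (le_trans (Wr i))// ge_min lexx orbT.
  apply: le_trans; rewrite !joint_cdfE -!EFinB lee_fin.
  have := near_x (- (3 * e)); rewrite normrN => /(_ ce).
  by rewrite ler_norml -/x'; lra.
apply: le_trans (_ : (\int[P]_w (smooth_box x e (S w))%:E <= _)%E).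
  apply: test_fun_integral_ge => //; first exact: smooth_box_test_fun.
  by move=> w wS; exact: smooth_box_in.
have [|_ /le_trans] := clt1 _ _ _ _ _ _ Xiid WW.
  by move=> i; rewrite (le_trans (Wr i))// ge_min lexx.
apply; rewrite !joint_cdfE -!EFinD lee_fin.
by have := near_x (3 * e) ce; rewrite ler_norml; lra.
Qed.

End clt.

(** * Fixed-design regression *)

(** The noise level is v = sqrt(p T). The first two smallness conditions bound 2v and the penalty
    term each by q mb/8, where q = sqrt(n rho). The third bounds 6 v sqrt n by 6/16 of n lambda and
    n (2v/q) by 1/8 of it, so half of n lambda is left over. The bounds [rho <= 1] and [1 <= mx]
    allow extra factors to be dropped. *)
Lemma scad_conditions (R : realType) (n p k rho lam mb mx a T : R) :
  0 < n -> 0 < p -> 1 <= k -> 0 < rho -> rho <= 1 -> 0 < lam -> 0 < mb ->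
  1 <= mx -> 2 < a -> 0 < T ->
  Num.sqrt p / (Num.sqrt (n * rho) * mb) <= (16 * Num.sqrt T)^-1 ->
  Num.sqrt k * lam / (Num.sqrt rho * mb) <= (8 * (a + 1))^-1 ->
  Num.sqrt (mx * p) / (Num.sqrt n * rho * lam) <= (16 * Num.sqrt T)^-1 ->
  [/\ 2 * Num.sqrt (p * T) + Num.sqrt (n * (k * ((a + 1) * lam ^+ 2 / 2))) <=
        Num.sqrt (n * rho) * (mb / 4),
      a * lam < mb / 2 &
      6 * Num.sqrt (p * T) * Num.sqrt n +
        n * (2 * Num.sqrt (p * T) / Num.sqrt (n * rho)) < n * lam].
Proof.
move=> n0 p0 k1 r0 r1 l0 mb0 mx1 a2 T0.
have k0 : 0 < k by exact: lt_le_trans k1.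
have mx0 : 0 < mx by exact: lt_le_trans mx1.
have a0 : 0 < a + 1 by lra.
rewrite (_ : n * (k * ((a + 1) * lam ^+ 2 / 2)) =
  n * (k * ((a + 1) / 2 * lam ^+ 2))); last by ring.
have a20 : 0 < (a + 1) / 2 by rewrite divr_gt0.
have sM (y z : R) : 0 < y -> Num.sqrt (y * z) = Num.sqrt y * Num.sqrt z.
  by move=> y0; rewrite sqrtrM// ltW.
rewrite (sM n rho n0) (sM mx p mx0) (sM p T p0) (sM n _ n0) (sM k _ k0).
rewrite (sM ((a + 1) / 2) _ a20) sqrtr_sqr gtr0_norm//.
have sq (y : R) : 0 < y -> exists s, [/\ Num.sqrt y = s, 0 < s & y = s ^+ 2].
  by move=> y0; exists (Num.sqrt y); rewrite sqrtr_gt0 sqr_sqrtr// ltW.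
have [sn [-> sn0 nE]] := sq _ n0.
have [sp [-> sp0 pE]] := sq _ p0.
have [sk [-> sk0 kE]] := sq _ k0.
have [sr [-> sr0 rE]] := sq _ r0.
have [st [-> st0 TE]] := sq _ T0.
have [sm [-> sm0 mE]] := sq _ mx0.
have [sa [saE sa0 aE]] := sq _ a20.
rewrite saE.
have sr1 : sr <= 1 by rewrite -(@expr_le1 _ 2)// -?rE// ltW.
have sk1 : 1 <= sk by rewrite -(@expr_ge1 _ 2)// -?kE// ltW.
have sm1 : 1 <= sm by rewrite -(@expr_ge1 _ 2)// -?mE// ltW.
have sa_le : sa <= a + 1 by nra.
rewrite ler_pdivrMr ?mulr_gt0// [leRHS]mulrC ler_pdivlMr ?mulr_gt0// => C1.
rewrite ler_pdivrMr ?mulr_gt0// [leRHS]mulrC ler_pdivlMr ?mulr_gt0// => C2.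
rewrite ler_pdivrMr ?mulr_gt0// [leRHS]mulrC ler_pdivlMr ?mulr_gt0// => C3.
have lam_le : sk * lam * (8 * (a + 1)) <= mb.
  by rewrite (le_trans C2)// ler_piMl// ltW.
have lam_le1 : 8 * (lam * (a + 1)) <= mb.
  rewrite (le_trans _ lam_le)//.
  have := ler_wpM2r (ltW (mulr_gt0 l0 a0)) sk1; lra.
split.
- have h1 : 2 * (sp * st) <= sn * sr * (mb / 8) by lra.
  have h2 : sk * lam * sa * 8 <= sr * mb.
    rewrite (le_trans _ C2)//.
    have := ler_wpM2l (ltW (mulr_gt0 sk0 l0)) sa_le; lra.
  have := ler_wpM2l (ltW sn0) h2; lra.
- lra.
have C4 : sp * st * 16 <= sn * sr * sr * lam.
  have := ler_wpM2r (ltW (mulr_gt0 sp0 st0)) sm1.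
  move: C3; rewrite rE; lra.
have e1 : n * (2 * (sp * st) / (sn * sr)) = 2 * sn * (sp * st) / sr.
  by rewrite nE; field; rewrite !gt_eqF.
have h3 : 2 * sn * (sp * st) / sr <= n * lam / 8.
  rewrite ler_pdivrMr//; have := ler_wpM2l (ltW sn0) C4.
  have : sn * (sn * sr * sr * lam) <= n * lam * sr.
    have -> : sn * (sn * sr * sr * lam) = (n * lam * sr) * sr by rewrite nE; ring.
    by rewrite ler_piMr// !mulr_ge0// ltW.
  lra.
have h4 : 6 * (sp * st) * sn <= n * lam * (6 / 16).
  have := ler_wpM2l (ltW sn0) C4.
  have : sn * (sn * sr * sr * lam) <= n * lam.
    have -> : sn * (sn * sr * sr * lam) = (n * lam) * (sr * sr) by rewrite nE; ring.
    by rewrite ler_piMr ?mulr_ile1// ?mulr_ge0// ltW.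
  lra.
have nl : 0 < n * lam by rewrite mulr_gt0.
rewrite e1; lra.
Qed.

Section hat_matrix.
Variables (R : realType) (n p : nat) (X : 'M[R]_(n, p)).
Hypothesis Gu : X^T *m X \in unitmx.

Definition hat_matrix : 'M[R]_n := X *m invmx (X^T *m X) *m X^T.

Lemma hat_matrix_sym : hat_matrix^T = hat_matrix.
Proof. by rewrite /hat_matrix !trmx_mul trmx_inv trmx_mul !trmxK mulmxA. Qed.

Lemma hat_matrix_mul m (Z : 'M[R]_(p, m)) : hat_matrix *m (X *m Z) = X *m Z.
Proof. by rewrite /hat_matrix -!mulmxA (mulmxA X^T) mulKmx. Qed.

Lemma hat_matrix_trace : \tr (hat_matrix *m hat_matrix^T) = p%:R.
Proof.
rewrite hat_matrix_sym {2}/hat_matrix -mulmxA hat_matrix_mul mulmxA.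
by rewrite mxtrace_mulC mulmxA mulmxV// mxtrace1.
Qed.

(** Against the column space only the projection of [e] counts. Its expected squared norm is
    proportional to p rather than n, which is what the rate conditions can afford. *)
Lemma dot_hat_matrix (e : 'cV[R]_n) (u : 'cV[R]_p) :
  `|dot e (X *m u)| <= enorm (hat_matrix *m e) * enorm (X *m u).
Proof.
rewrite -(hat_matrix_mul u) -{1}hat_matrix_sym -dot_mulmx hat_matrix_mul.
rewrite -ler_sqr ?nnegrE// ?mulr_ge0 ?enorm_ge0// real_normK ?num_real//.
by rewrite exprMn cauchy_schwarz.
Qed.

End hat_matrix.

Section design.
Variables (R : realType) (n p : nat) (X : 'M[R]_(n, p)).
Hypothesis n0 : (0 < n)%N.
Let M := n%:R^-1 *: (X^T *m X).

Lemma quadform_gram (u : 'cV[R]_p) : dot u (M *m u) = n%:R^-1 * enorm (X *m u) ^+ 2.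
Proof.
by rewrite /M -scalemxAl dotZr -mulmxA enorm_sqr dot_mulmx.
Qed.

Let Ms : M^T = M. Proof. by rewrite /M linearZ/= trmx_mul trmxK. Qed.

Lemma min_eigenvalue_enorm : 0 < min_eigenvalue M ->
  forall u, Num.sqrt (n%:R * min_eigenvalue M) * enorm u <= enorm (X *m u).
Proof.
move=> rho0 u; have nR0 : 0 < n%:R :> R by rewrite ltr0n.
rewrite -ler_sqr ?nnegrE ?mulr_ge0 ?sqrtr_ge0 ?enorm_ge0//.
rewrite exprMn sqr_sqrtr; last by rewrite mulr_ge0// ltW.
rewrite -mulrA -ler_pdivlMl// -quadform_gram.
exact: min_eigenvalue_le.
Qed.

Lemma enorm_delta (j : 'I_p) : enorm (delta_mx j 0 : 'cV[R]_p) ^+ 2 = 1.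
Proof.
rewrite enorm_sqr dotE (bigD1 j)//= big1 ?addr0.
  by rewrite !mxE !eqxx mulr1.
by move=> i ij; rewrite !mxE (negbTE ij) mul0r.
Qed.

Lemma quadform_delta (j : 'I_p) : enorm (col j X) ^+ 2 = n%:R ->
  dot (delta_mx j 0) (M *m delta_mx j 0) = 1.
Proof.
move=> Xj; rewrite quadform_gram -colE Xj mulVf// pnatr_eq0.
by rewrite -lt0n.
Qed.

(** Evaluation of the quadratic form at a basis vector: a column of squared norm n gives the
    diagonal entry 1. *)
Lemma min_eigenvalue_le1 (j : 'I_p) : enorm (col j X) ^+ 2 = n%:R ->
  min_eigenvalue M <= 1.
Proof.
move=> Xj; have := min_eigenvalue_le (delta_mx j 0) Ms.
by rewrite enorm_delta mulr1 (quadform_delta Xj).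
Qed.

Lemma max_eigenvalue_ge1 (j : 'I_p) : enorm (col j X) ^+ 2 = n%:R ->
  1 <= max_eigenvalue M.
Proof.
move=> Xj; have := le_max_eigenvalue (delta_mx j 0) Ms.
by rewrite enorm_delta mulr1 (quadform_delta Xj).
Qed.

End design.

(** Positivity survives the infimum because a minimum over finitely many indices is attained; with
    no index, [inf] would be 0. *)
Lemma inf_range_ord (R : realType) k (f : 'I_k -> R) : (0 < k)%N ->
  (forall j, 0 < f j) -> 0 < inf (range f) /\ forall j, inf (range f) <= f j.
Proof.
move=> k0 f0; have lb : has_lbound (range f).
  by exists 0 => _ [j _ <-]; exact: ltW.
split; last by move=> j; apply: ge_inf => //; exists j.
pose j0 : 'I_k := Ordinal k0.
pose jm := [arg min_(j < j0) f j]%O.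
apply: lt_le_trans (f0 jm) _; apply: lb_le_inf; first by exists (f j0); exists j0.
by move=> _ [j _ <-]; rewrite /jm; case: arg_minP => // i _; exact.
Qed.

Lemma sup_range_ord (R : realType) k (f : 'I_k -> R) j : f j <= sup (range f).
Proof.
apply: ub_le_sup; last by exists j.
exists (\sum_i `|f i|) => _ [i _ <-].
by rewrite (bigD1 i)//= (le_trans (ler_norm _))// lerDl sumr_ge0.
Qed.

Theorem theorem5 (R : realType)
    (disp : nat -> measure_display)
    (Omega : forall n, measurableType (disp n))
    (P : forall n, probability (Omega n) R)
    (k m : nat -> nat)
    (X : forall n, 'M[R]_(n, k n + m n))
    (beta : forall n, 'cV[R]_(k n + m n))
    (eps : forall n, 'I_n -> {RV (P n) >-> R})
    (Y : forall n, Omega n -> 'cV[R]_n)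
    (sigma a : R) (lambda : nat -> R)
    (nu : probability (measurableTypeR R) R)
    (betahat : forall n, Omega n -> 'cV[R]_(k n + m n))
    (d : nat) (A : forall n, 'M[R]_(d, k n)) :
  let p := fun n => (k n + m n)%N in
  let X1 := fun n => lsubmx (X n) in
  let X2 := fun n => rsubmx (X n) in
  let beta1 := fun n => usubmx (beta n) in
  let beta2 := fun n => dsubmx (beta n) in
  let rho := fun n => min_eigenvalue (n%:R^-1 *: ((X n)^T *m X n)) in
  let pi1 := fun n => max_eigenvalue (n%:R^-1 *: ((X1 n)^T *m X1 n)) in
  let omega2 := fun n => max_eigenvalue (n%:R^-1 *: ((X2 n)^T *m X2 n)) in
  let minbeta := fun n => inf (range (fun j : 'I_(k n) => `|beta1 n j 0|)) in
  let Sigma := fun n =>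
    sigma ^+ 2 *: (A n *m invmx (n%:R^-1 *: gram (X1 n)) *m (A n)^T) in
  (* model *)
  (forall n w, Y n w = X n *m beta n + \col_(i < n) eps n i w) ->
  (forall n, (0 < n)%N -> forall j, beta1 n j 0 != 0) ->
  (forall n, (0 < n)%N -> beta2 n = 0) ->
  0 < sigma ->
  (* estimator *)
  2 < a ->
  (forall n, (0 < n)%N -> 0 < lambda n) ->
  (forall n j, (0 < n)%N ->
     measurable_fun setT (fun w => betahat n w j 0)) ->
  (forall n w, (0 < n)%N ->
     is_ls_scad (X n) (Y n w) (lambda n) a (betahat n w)) ->
  (* linear functionals *)
  (0 < d)%N ->
  (forall n, (0 < n)%N -> row_free (A n)) ->
  (* positivity of the smallest eigenvalue, for all large n *)
  (\forall n \near \oo, 0 < rho n) ->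
  (* (i) *)
  (forall n, iid_with_law (eps n) nu) ->
  (forall n i, ('E_(P n)[eps n i] = 0)%E) ->
  (forall n i, ('V_(P n)[eps n i] = (sigma ^+ 2)%:E)%E) ->
  (* (ii) *)
  (forall n, (0 < n)%N -> forall j, enorm (col j (X n)) ^+ 2 = n%:R) ->
  (* (iii) *)
  Num.sqrt (k n)%:R * lambda n / Num.sqrt (rho n) @[n --> \oo] --> (0 : R) ->
  Num.sqrt (p n)%:R / Num.sqrt (n%:R * rho n) @[n --> \oo] --> (0 : R) ->
  (* (iv) *)
  Num.sqrt (k n)%:R * lambda n / (Num.sqrt (rho n) * minbeta n)
    @[n --> \oo] --> (0 : R) ->
  Num.sqrt (p n)%:R / (Num.sqrt (n%:R * rho n) * minbeta n)
    @[n --> \oo] --> (0 : R) ->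
  Num.sqrt ((p n)%:R / n%:R) / rho n @[n --> \oo] --> (0 : R) ->
  (* (v) *)
  Num.sqrt (Num.max (pi1 n) (omega2 n) * (p n)%:R)
    / (Num.sqrt n%:R * rho n * lambda n) @[n --> \oo] --> (0 : R) ->
  (* (vi) *)
  sup (range (fun i : 'I_n =>
    ((obs (X1 n) i)^T *m invmx (gram (X1 n)) *m obs (X1 n) i) 0 0))
    @[n --> \oo] --> (0 : R) ->
  cvg_in_distribution P
    (fun n w => Num.sqrt n%:R *:
       (invsqrtmx (Sigma n) *m A n *m (usubmx (betahat n w) - beta1 n)))
    (std_normal R d).
Proof.
move=> p X1 X2 beta1 beta2 rho pi1 omega2 minbeta Sigma.
move=> YE b1ne0 b20 s0 a2 l0 mbh opt d0 Afree rho0 Xiid EX VX Xn.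
move=> _ _ c4a c4b _ c5 c6 x ctsx.
(* The law [nu] does not change with n, so its two moments are read off from the single error of the
   sample of size 1. *)
have law1 (B : set R) : measurable B -> distribution (P 1%N) (eps 1%N ord0) B = nu B.
  exact: (Xiid 1%N).2.
have nu1 := law_mean law1 (EX _ _).
have nu2 := law_second_moment law1 (EX _ _) (VX _ _).
have mle := measurable_tuple_le x.
have cdf_fin : joint_cdf (std_normal R d) x \is a fin_num.
  exact: (@fin_num_measure _ _ _ (std_normal R d) _ mle).
pose Z n w := Num.sqrt n%:R *:
  (invsqrtmx (Sigma n) *m A n *m (usubmx (betahat n w) - beta1 n)).
pose E n := [set w | forall i, Z n w i 0 <= x i 0].
have mE n : (0 < n)%N -> measurable (E n).
  move=> n0; apply: measurable_orthant => i.
  set Q := invsqrtmx (Sigma n) *m A n.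
  rewrite (_ : (fun _ => _) = (fun w => Num.sqrt n%:R *
      \sum_(j < k n) Q i j * (betahat n w (lshift (m n) j) 0 - beta1 n j 0))); last first.
    apply/funext => w; rewrite /Z -/Q mxE mxE; congr (_ * _).
    by apply: eq_bigr => j _; congr (_ * _); rewrite !mxE.
  apply: measurable_funM => //; apply: measurable_sum => j.
  apply: measurable_funM => //; apply: measurable_funB => //.
  exact: mbh.
suff near_cdf (eta : R) : 0 < eta -> \forall n \near \oo,
    (joint_cdf (std_normal R d) x - eta%:E <= P n (E n) <=
     joint_cdf (std_normal R d) x + eta%:E)%E.
  rewrite -(fineK cdf_fin); apply/fine_cvgP; split.
    near=> n; apply: (@fin_num_measure _ _ _ (P n)); apply: mE.
    by near: n; exact: nbhs_infty_gt.
  apply/cvgrPdist_le => eta /near_cdf; apply: filterS => n /=.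
  move=> /andP[]; rewrite -(fineK cdf_fin) -EFinB -EFinD => h1 h2.
  have : P n (E n) \is a fin_num.
    by rewrite fin_numE -ltNye -ltey (lt_le_trans _ h1) ?ltNyr// (le_lt_trans h2) ?ltry.
  move=> Pfin; move: h1 h2; rewrite -/(E n) -(fineK Pfin) !lee_fin.
  by rewrite ler_norml; lra.
move=> eta0; have eta20 : 0 < eta / 2 by rewrite divr_gt0.
have [r r0 clt] := weighted_clt nu1 nu2 s0 eta20 ctsx.
(* The projected error has expected squared norm p sigma^2, so Markov's inequality at level p T
   leaves an exceptional event of probability at most sigma^2/T = eta/2. *)
pose T := 2 * sigma ^+ 2 / eta; have T0 : 0 < T.
  by rewrite divr_gt0// mulr_gt0// exprn_gt0.
have st0 : 0 < (16 * Num.sqrt T)^-1 by rewrite invr_gt0 mulr_gt0// sqrtr_gt0.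
have sa0 : 0 < (8 * (a + 1))^-1 by rewrite invr_gt0; lra.
(* Leverages below this level give columns of the weight matrix of norm at most [r], since a squared
   column norm is at most sigma^-2 times the leverage. *)
have lev0 : 0 < sigma ^+ 2 * r ^+ 2 by rewrite mulr_gt0// exprn_gt0.
have upto (u : nat -> R) (c : R) : 0 < c -> u n @[n --> \oo] --> (0 : R) ->
    \forall n \near \oo, u n <= c.
  move=> c0 /cvgrPdist_le /(_ c c0); apply: filterS => n.
  by rewrite sub0r normrN => /(le_trans (ler_norm _)).
near=> n.
have n0 : (0 < n)%N by near: n; exact: nbhs_infty_gt.
have rn0 : 0 < rho n by near: n.
have C1 : Num.sqrt (p n)%:R / (Num.sqrt (n%:R * rho n) * minbeta n) <=
    (16 * Num.sqrt T)^-1 by near: n; exact: upto.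
have C2 : Num.sqrt (k n)%:R * lambda n / (Num.sqrt (rho n) * minbeta n) <=
    (8 * (a + 1))^-1 by near: n; exact: upto.
have C3 : Num.sqrt (Num.max (pi1 n) (omega2 n) * (p n)%:R)
    / (Num.sqrt n%:R * rho n * lambda n) <= (16 * Num.sqrt T)^-1.
  by near: n; exact: upto.
have C4 : sup (range (fun i : 'I_n =>
    ((obs (X1 n) i)^T *m invmx (gram (X1 n)) *m obs (X1 n) i) 0 0)) <=
    sigma ^+ 2 * r ^+ 2 by near: n; exact: upto.
(* Full row rank together with d > 0 provides at least one nonzero coefficient, so that [minbeta n]
   is a true minimum and there is a column to test the eigenvalues on. *)
have kd : (d <= k n)%N.
  by have := Afree n n0; rewrite /row_free => /eqP <-; exact: rank_leq_col.
have k0 : (0 < k n)%N by exact: leq_trans kd.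
pose j0 : 'I_(k n) := Ordinal k0.
have nR0 : 0 < n%:R :> R by rewrite ltr0n.
have p0 : 0 < (p n)%:R :> R by rewrite ltr0n addn_gt0 k0.
have q0 : 0 < Num.sqrt (n%:R * rho n) by rewrite sqrtr_gt0 mulr_gt0.
have qX := min_eigenvalue_enorm n0 rn0.
have Gu := dot_unit_gram q0 qX.
have rn1 : rho n <= 1.
  exact: (min_eigenvalue_le1 n0 (Xn n n0 (lshift (m n) j0))).
have mx1 : 1 <= Num.max (pi1 n) (omega2 n).
  rewrite le_max (max_eigenvalue_ge1 n0 (j := j0))// /X1.
  rewrite -(Xn n n0 (lshift (m n) j0)); congr (enorm _ ^+ 2).
  by apply/colP => i; rewrite !mxE.
have [mb0 mb_le] : 0 < minbeta n /\ forall j, minbeta n <= `|beta1 n j 0|.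
  by apply: inf_range_ord => // j; rewrite normr_gt0; exact: b1ne0.
have k1 : 1 <= (k n)%:R :> R by rewrite ler1n.
have [N1 N2 N3] := scad_conditions nR0 p0 k1 rn0 rn1 (l0 n n0) mb0 mx1 a2 T0 C1 C2 C3.
have G1u : (X1 n)^T *m X1 n \in unitmx.
  have XE u : X n *m col_mx u 0 = X1 n *m u.
    by rewrite -[X n in LHS]hsubmxK mul_row_col mulmx0 addr0.
  apply: (dot_unit_gram q0) => u; have := qX (col_mx u 0); rewrite XE.
  rewrite {1}/enorm big_split_ord/= [X in _ + X]big1 ?addr0.
    by under eq_bigr do rewrite col_mxEu.
  by move=> i _; rewrite col_mxEd mxE expr0n.
pose H := hat_matrix (X n).
pose W := clt_weights (X1 n) (A n) sigma.
pose ep w := \col_(i < n) eps n i w.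
pose S w := W *m ep w.
pose bad := [set w | (p n)%:R * T < enorm (H *m ep w) ^+ 2].
have pT0 : 0 < (p n)%:R * T by rewrite mulr_gt0.
have [mbad Pbad] := markov_sqr_norm H (Xiid n) nu1 nu2 pT0.
have {}Pbad : (P n bad <= (eta / 2)%:E)%E.
  apply: le_trans Pbad _; rewrite hat_matrix_trace// lee_fin -/(p n) /T.
  move: (p n)%:R p0 => pR p0.
  rewrite le_eqVlt; apply/orP; left; apply/eqP; field.
  by rewrite !gt_eqF.
have ZS w : ~ bad w -> Z n w = S w.
  move=> /negP; rewrite -leNgt => good.
  have v0 : 0 <= Num.sqrt ((p n)%:R * T) by exact: sqrtr_ge0.
  have vX u : `|dot (ep w) (X n *m u)| <= Num.sqrt ((p n)%:R * T) * enorm (X n *m u).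
    apply: le_trans (dot_hat_matrix Gu _ _) _.
    rewrite ler_wpM2r ?enorm_ge0// -ler_sqr ?nnegrE ?enorm_ge0//.
    by rewrite [leRHS]sqr_sqrtr// ltW.
  have rr : 0 <= n%:R * ((k n)%:R * ((a + 1) * lambda n ^+ 2 / 2)).
    have ln0 := ltW (l0 n n0).
    by rewrite mulr_ge0// mulr_ge0// divr_ge0// mulr_ge0 ?sqr_ge0//; lra.
  have [_ u1E] := scad_oracle n0 (l0 n n0) a2 (Xn n n0) q0 qX v0 vX (b20 n n0) mb0
    mb_le (sqrtr_ge0 _) (sqr_sqrtr rr) N1 N2 N3
    (eq_ind _ (fun y => is_ls_scad _ y _ _ _) (opt n w n0) _ (YE n w)).
  rewrite /Z /S /W /clt_weights -/(beta1 n) u1E -scalemxAl !mulmxA.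
  by rewrite /Sigma.
have Wgram : W *m W^T = (sigma ^- 2)%:M by apply: clt_weights_gram => //; exact: Afree.
have Wr i : enorm (col i W) <= r.
  rewrite -ler_sqr ?nnegrE ?enorm_ge0 ?(ltW r0)//.
  apply: le_trans (clt_weights_leverage n0 s0 G1u (Afree n n0) i) _.
  rewrite ler_pdivrMl ?exprn_gt0//; apply: le_trans C4.
  exact: (sup_range_ord (fun i : 'I_n =>
    ((obs (X1 n) i)^T *m invmx (gram (X1 n)) *m obs (X1 n) i) 0 0)).
have [lo up] := clt _ _ (P n) n (eps n) W (Xiid n) Wgram Wr.
pose F := [set w | forall i, S w i 0 <= x i 0].
have mF : measurable F := measurable_orthant x (measurable_linear_form (eps n) W).
(* The normalized estimator and the linear form coincide off [bad], so the two events differ in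
   probability by at most eta/2; the limit theorem accounts for the other half. *)
have EF : (P n (E n) <= P n F + P n bad)%E.
  apply: le_trans (measureU2 _ mF mbad); apply: le_measure; rewrite ?inE.
  - exact: mE.
  - exact: measurableU.
  - move=> w Ew; have [bw|gw] := pselect (bad w); [by right|left].
    by rewrite /F/= -ZS.
have FE : (P n F <= P n (E n) + P n bad)%E.
  apply: le_trans (measureU2 _ (mE n n0) mbad); apply: le_measure; rewrite ?inE.
  - exact: mF.
  - by apply: measurableU => //; exact: mE.
  - move=> w Fw; have [bw|gw] := pselect (bad w); [by right|left].
    by rewrite /E/= ZS.
have finm (B : set (Omega n)) : measurable B -> P n B \is a fin_num.
  by move=> mB; exact: (@fin_num_measure _ _ _ (P n)).
move: lo up EF FE Pbad; rewrite -/F -(fineK cdf_fin) -(fineK (finm _ mF)).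
rewrite -(fineK (finm _ (mE n n0))) -(fineK (finm _ mbad)).
rewrite -!EFinB -!EFinD !lee_fin => lo up EF FE Pbad.
by apply/andP; split; lra.
Unshelve. all: by end_near. Qed.
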